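(* $t_2(n,n-2)=n+2$ for all $n\ge 6$, and $t_2(n,n-1)=n+1$ for all $n\ge 4$.
   Context: All graphs are finite, simple and undirected. An $r$-colouring of a graph $G$ is a function $c:E(G)\to\{1,\dots,r\}$ (not necessarily proper). A path is rainbow if all its edges have distinct colours. For a $2$-connected graph $G$, a colouring is rainbow $2$-connected if every two vertices of $G$ are connected by two internally vertex-disjoint rainbow paths, and the rainbow $2$-connection number $rc_2(G)$ is the minimum number of colours in a rainbow $2$-connected colouring of $G$. For integers $n$ and $r\ge 1$, $t_2(n,r)$ denotes the minimum number of edges in a $2$-connected graph $G$ on $n$ vertices with $rc_2(G)\le r$. *)

(* Defs.v *)
From mathcomp Require Import all_boot.

Set Implicit Arguments.
Unset Strict Implicit.
Unset Printing Implicit Defensive.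

Record sgraph (T : finType) := SGraph {
  adj :> rel T;
  adj_sym : symmetric adj;
  adj_irr : irreflexive adj
}.

Definition edges (T : finType) (G : sgraph T) : {set {set T}} :=
  [set [set x; y] | x in T, y in T & G x y].

(* The subgraph induced on S is connected. *)
Definition connected_in (T : finType) (G : sgraph T) (S : {set T}) : Prop :=
  forall x y : T, x \in S -> y \in S ->
    connect [rel a b | [&& a \in S, b \in S & G a b]] x y.

(* More than k vertices, and deleting fewer than k of them never disconnects. *)
Definition k_connected (k : nat) (T : finType) (G : sgraph T) : Prop :=
  k < #|T| /\ forall X : {set T}, #|X| < k -> connected_in G (~: X).

(* Colours are attached to all sets of vertices, but only the values on the
   edges of the graph are constrained or ever used. *)
Definition colouring (T : finType) (G : sgraph T) (r : nat)
    (c : {set T} -> nat) : Prop :=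
  forall e : {set T}, e \in edges G -> 1 <= c e <= r.

(* A path from u to v is given by u and the sequence p of the vertices
   following u. *)
Definition is_path (T : finType) (G : sgraph T) (u v : T) (p : seq T) : bool :=
  [&& path G u p, last u p == v & uniq (u :: p)].

Definition path_edges (T : finType) (u : T) (p : seq T) : seq {set T} :=
  pairmap (fun x y => [set x; y]) u p.

Definition inner (T : finType) (u : T) (p : seq T) : seq T :=
  behead (belast u p).

Definition rainbow (T : finType) (c : {set T} -> nat) (u : T) (p : seq T)
    : bool :=
  uniq [seq c e | e <- path_edges u p].

(* The condition p != q matters for adjacent u and v: a single edge has no
   inner vertex, hence is internally disjoint from itself. *)
Definition rainbow_2connected (T : finType) (G : sgraph T)
    (c : {set T} -> nat) : Prop :=
  forall u v : T, u != v ->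
    exists p q : seq T,
      [/\ is_path G u v p && rainbow c u p,
          is_path G u v q && rainbow c u q,
          p != q
        & ~~ has (mem (inner u p)) (inner u q)].

Definition is_minimum (P : nat -> Prop) (m : nat) : Prop :=
  P m /\ forall k : nat, P k -> m <= k.

(* Minima are rendered as relations, so that asserting a value also asserts
   that the minimum is attained: is_rc2 G k reads rc_2(G) = k, and is_t2 n r m
   reads t_2(n, r) = m. *)
Definition is_rc2 (T : finType) (G : sgraph T) (k : nat) : Prop :=
  is_minimum
    (fun r => exists c : {set T} -> nat,
       colouring G r c /\ rainbow_2connected G c) k.

Definition is_t2 (n r m : nat) : Prop :=
  is_minimum
    (fun e => exists (T : finType) (G : sgraph T),
       [/\ #|T| = n,
           k_connected 2 G,
           exists2 k : nat, is_rc2 G k & k <= r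
         & #|edges G| = e]) m.

(* Main.v *)
Require Import Defs.
From mathcomp Require Import all_boot zify.
From Stdlib Require Import Classical.

Set Implicit Arguments.
Unset Strict Implicit.
Unset Printing Implicit Defensive.

(* Lower bounds: all degrees are at least 2. With at most n edges the graph is
   a cycle, and the two ends of an edge force the other n - 1 edges to have
   different colours; hence all n colours differ. With n + 1 edges the graph
   consists of three threads between two vertices x and y of degree 3. Two
   disjoint rainbow paths between neighbours of x on two threads give a path
   through y, so the edges not incident with x have different colours, and
   likewise for y. When no thread is a single edge, these are n - 2 colours;
   if there were no other colour, the three first and the three last edges of
   the threads would carry the same three colours, which contradicts the
   existence of a cycle through a middle edge that is rainbow off that edge.
   A thread that is a single edge is handled similarly.
   Upper bounds: join one or two new vertices to two adjacent vertices of a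
   rainbow cycle. *)

(** * Paths and their edges *)

Lemma set2_eq (T : finType) (a b c d : T) :
  [set a; b] = [set c; d] -> (a = c /\ b = d) \/ (a = d /\ b = c).
Proof.
move=> E.
have := set21 a b; have := set22 a b; rewrite E !inE.
have := set21 c d; have := set22 c d; rewrite -E !inE.
by do 4!(case/orP=> /eqP ?); subst; auto.
Qed.

Lemma set2_inj (T : finType) (a b c : T) : [set a; b] = [set a; c] -> b = c.
Proof. by case/set2_eq=> [] [] // -> ->. Qed.

Section Paths.
Variables (T : finType) (G : sgraph T).
Implicit Types (u v x y z : T) (p q : seq T).

Lemma path_edges_cat u p q :
  path_edges u (p ++ q) = path_edges u p ++ path_edges (last u p) q.
Proof. by rewrite /path_edges pairmap_cat. Qed.

Lemma path_edges_rcons u p z :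
  path_edges u (rcons p z) = rcons (path_edges u p) [set last u p; z].
Proof. by rewrite -cats1 path_edges_cat /= cats1. Qed.

Lemma path_edges_rev u p :
  path_edges (last u p) (rev (belast u p)) = rev (path_edges u p).
Proof.
elim: p u => [|a p IH] u //=.
by rewrite !rev_cons path_edges_rcons IH setUC /=; congr rcons; case: p {IH} => [|b p] //=; rewrite rev_cons last_rcons.
Qed.

Lemma mem_path_edges u p (e : {set T}) z :
  e \in path_edges u p -> z \in e -> z \in u :: p.
Proof.
elim: p u => [|a p IH] u //=; rewrite inE => /orP[/eqP->|/IH H /H].
  by rewrite !inE => /orP[]/eqP->; rewrite eqxx ?orbT.
by move=> H'; rewrite inE H' orbT.
Qed.

Lemma path_edges_split u p e : e \in path_edges u p ->
  exists p1 z p2, p = p1 ++ z :: p2 /\ e = [set last u p1; z].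
Proof.
elim: p u => [|a p IH] u //=; rewrite inE => /orP[/eqP->|/IH [p1 [z [p2 [-> ->]]]]].
  by exists [::], a, p.
by exists (a :: p1), z, p2.
Qed.

Lemma path_edges_adj u p a b : path G u p ->
  [set a; b] \in path_edges u p -> G a b.
Proof.
move=> pp /path_edges_split[p1 [z [p2 [E /set2_eq H]]]].
move: pp; rewrite E cat_path /= => /and3P[_ + _].
by case: H => [[-> ->]|[-> ->]] //; rewrite adj_sym.
Qed.

Lemma uniq_path_edges u p : uniq (u :: p) -> uniq (path_edges u p).
Proof.
elim: p u => [|a p IH] u //= /andP[up /andP[ap Up]].
rewrite IH /= ?ap // andbT; apply/negP => /mem_path_edges/(_ (set21 u a)).
by rewrite (negPf up).
Qed.

Lemma mem_inner u v p z : is_path G u v p ->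
  (z \in inner u p) = (z \in p) && (z != v).
Proof.
case/and3P=> _ /eqP; case/lastP: p => [|p w]; first by rewrite /inner.
rewrite last_rcons => ->; rewrite cons_uniq => /andP[_]; rewrite rcons_uniq => /andP[vp _].
rewrite /inner belast_rcons /= mem_rcons inE.
by case: eqVneq => [->|] /=; rewrite ?(negPf vp) ?andbT.
Qed.

Lemma is_path_rev u v p : is_path G u v p ->
  is_path G v u (rev (belast u p)) .
Proof.
case/and3P=> pp /eqP E U; subst v; apply/and3P; split.
- by rewrite rev_path; congr is_true: pp; apply: eq_path => a b; apply: adj_sym.
- by case: p pp U => [|a p] //= _ _; rewrite rev_cons last_rcons.
have -> : last u p :: rev (belast u p) = rev (u :: p).
  by rewrite -rev_rcons -lastI.
by rewrite rev_uniq.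
Qed.

Definition nbrs v : {set T} := [set w | G v w].

(** Predecessor and successor of z on the path differ, since a path repeats no vertex. *)
Lemma inner_two u v p z : is_path G u v p -> z \in p -> z != v ->
  exists b1 b2, [/\ b1 != b2, G z b1, G z b2,
    [set z; b1] \in path_edges u p & [set z; b2] \in path_edges u p].
Proof.
case/and3P=> pp /eqP lp U zp zv.
case/splitPr: zp pp lp U => p1 [|b p2]; first by rewrite last_cat /= => _ E; rewrite E eqxx in zv.
rewrite cat_path => /andP[_ /and3P[G1 G2 _]] _.
rewrite -cat_cons cat_uniq => /and3P[_ H _].
exists (last u p1), b; split=> //; rewrite ?path_edges_cat /=.
- by apply: contra H => /eqP E; rewrite [has _ _]/= -E mem_last orbT.
- by rewrite adj_sym.
- by rewrite mem_cat !inE setUC eqxx orbT.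
by rewrite mem_cat !inE eqxx !orbT.
Qed.

Lemma nbrs2 z b1 b2 w : #|nbrs z| = 2 -> b1 != b2 -> G z b1 -> G z b2 ->
  G z w -> (w == b1) || (w == b2).
Proof.
move=> d2 n12 g1 g2 gw.
have S : [set b1; b2] \subset nbrs z.
  by apply/subsetP=> t; rewrite !inE => /orP[]/eqP->.
have /eqP E : [set b1; b2] == nbrs z by rewrite eqEcard S d2 cards2 n12.
have : w \in nbrs z by rewrite inE.
by rewrite -E !inE.
Qed.

Lemma nbrs3 z b1 b2 b3 w : #|nbrs z| = 3 -> uniq [:: b1; b2; b3] ->
  G z b1 -> G z b2 -> G z b3 -> G z w -> w \in [:: b1; b2; b3].
Proof.
move=> d3 U g1 g2 g3 gw.
have S : [set t in [:: b1; b2; b3]] \subset nbrs z.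
  by apply/subsetP=> t; rewrite !inE => /or3P[]/eqP->.
have /eqP E : [set t in [:: b1; b2; b3]] == nbrs z.
  by rewrite eqEcard S d3 cardsE (card_uniqP U).
have : w \in nbrs z by rewrite inE.
by rewrite -E !inE.
Qed.

(** The path already spends two edges at its inner vertex z, so degree 2 leaves no edge outside it.
    This is what forces rainbow paths to follow threads. *)
Lemma inner_saturated u v p z w : is_path G u v p -> z \in p -> z != v ->
  #|nbrs z| = 2 -> G z w -> [set z; w] \in path_edges u p.
Proof.
move=> P zp zv d2 gw; have [b1 [b2 [n g1 g2 e1 e2]]] := inner_two P zp zv.
by case/orP: (nbrs2 d2 n g1 g2 gw) => /eqP->.
Qed.

Lemma edge_at_end u v p : is_path G u v p -> u != v ->
  (exists2 t, G u t & [set u; t] \in path_edges u p) /\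
  (exists2 t, G v t & [set v; t] \in path_edges u p).
Proof.
move=> /and3P[pp /eqP lp _] uv; split.
  case: p pp lp => [|a p] /=; first by move=> _ E; rewrite E eqxx in uv.
  by case/andP=> g _ _; exists a; rewrite ?inE ?eqxx.
case/lastP: p pp lp => [|p a]; first by move=> _ E; rewrite -E eqxx in uv.
rewrite rcons_path last_rcons => /andP[_ g] <-; exists (last u p); first by rewrite adj_sym.
by rewrite path_edges_rcons mem_rcons inE setUC eqxx.
Qed.

Definition disjoint_paths u v p q :=
  [/\ is_path G u v p, is_path G u v q, p != q
    & ~~ has (mem (inner u p)) (inner u q)].

Lemma disjoint_pathsC u v p q : disjoint_paths u v p q -> disjoint_paths u v q p.
Proof.
case=> P Q n D; split=> //; first by rewrite eq_sym.
by apply: contra D => /hasP[z /= z1 z2]; apply/hasP; exists z.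
Qed.

(** A common first vertex would be a common inner vertex or, if it is v, both paths would be the
    single edge from u to v and hence equal. *)
Lemma disjoint_paths_head u v p q : u != v -> disjoint_paths u v p q ->
  exists a p' b q', [/\ p = a :: p', q = b :: q', a != b, G u a & G u b].
Proof.
move=> uv [P Q n D].
case: p P n D => [|a p]; first by case/and3P=> _ /=; rewrite (negPf uv).
case: q Q => [|b q]; first by case/and3P=> _ /=; rewrite (negPf uv).
move=> Q P n D; exists a, p, b, q; split=> //; last first.
- by case/and3P: Q => /andP[].
- by case/and3P: P => /andP[].
apply/eqP=> ab; subst b.
case: (eqVneq a v) => av.
  subst v; case/negP: n; case/and3P: P => _ /= l1 /and3P[_ a1 _].
  case/and3P: Q => _ /= l2 /and3P[_ a2 _].
  case: p l1 a1 {D} => [|? p] /eqP /= l1 a1; last by rewrite -{1}l1 mem_last in a1.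
  case: q l2 a2 => [|? q] /eqP /= l2 a2; last by rewrite -{1}l2 mem_last in a2.
  exact: eqxx.
by case/negP: D; apply/hasP; exists a => /=; rewrite (mem_inner _ P, mem_inner _ Q) inE eqxx.
Qed.

Lemma disjoint_paths_avoid u v p q z : disjoint_paths u v p q ->
  z != v -> (z \notin p) || (z \notin q).
Proof.
case=> P Q _ D zv; rewrite -negb_and; apply: contra D => /andP[zp zq].
by apply/hasP; exists z => /=; rewrite (mem_inner _ P, mem_inner _ Q) ?zp ?zq.
Qed.

(** Propagation principle: F passes between the two path edges at every inner vertex, so it spreads
    from one edge in both directions. Later F is membership in some rainbow path. *)
Lemma path_edges_all (F : pred {set T}) u p : path G u p ->
  (forall z, z \in inner u p -> forall a b, G z a -> G z b ->
     F [set z; a] -> F [set z; b]) ->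
  has F (path_edges u p) -> all F (path_edges u p).
Proof.
elim: p u => [|a [|b p] IH] u //.
set q := b :: p in IH *; move=> /andP[ua pq] thr.
have {}IH := IH a pq.
have aI : a \in inner u (a :: q) by rewrite /inner /= inE eqxx.
have IHt : has F (path_edges a q) -> all F (path_edges a q).
  by apply: IH => z zi; apply: thr; move: zi; rewrite /inner /= inE => ->; rewrite orbT.
have ab : G a b by case/andP: pq.
have au : G a u by rewrite adj_sym.
have -> : path_edges u (a :: q) = [set u; a] :: path_edges a q by [].
rewrite [has _ (_ :: _)]/= [all _ (_ :: _)]/= => /orP[Fu|Fq].
  apply/andP; split=> //; apply: IHt; apply/hasP; exists [set a; b].
    by rewrite inE eqxx.
  by apply: (thr _ aI u b) => //; rewrite setUC.
have Fa := IHt Fq; apply/andP; split; last exact: Fa.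
rewrite setUC; by apply: (thr _ aI b u) => //; case/andP: Fa.
Qed.

End Paths.

(** * Degrees, and graphs with as many edges as vertices *)

Lemma uniq_map_inj_in (T1 T2 : eqType) (f : T1 -> T2) (s : seq T1) :
  uniq (map f s) -> {in s &, injective f}.
Proof.
elim: s => [|a s IH] //= /andP[fa U] d e; rewrite !inE.
case/orP=> [/eqP->|ds] /orP[/eqP->|es] // E; last by apply: IH E.
  by case/mapP: fa; exists e.
by case/mapP: fa; exists d.
Qed.

Section Degrees.
Variables (T : finType) (G : sgraph T).

Lemma edgesP (e : {set T}) :
  reflect (exists a b, G a b /\ e = [set a; b]) (e \in edges G).
Proof.
apply: (iffP imset2P) => [[a b _]|[a [b [g ->]]]].
  by rewrite inE => /andP[_ g] ->; exists a, b.
by exists a b; rewrite ?inE.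
Qed.

(** Double counting of the incidences between vertices and edges. *)
Lemma handshake : \sum_v #|nbrs G v| = 2 * #|edges G|.
Proof.
have degE v : #|nbrs G v| = \sum_(e in edges G) (v \in e).
  rewrite -big_mkcondr sum1_card /=.
  rewrite -(card_imset (nbrs G v) (@set2_inj _ v)); apply: eq_card => e.
  rewrite unfold_in /=; apply/imsetP/andP => [[w]|[/edgesP[a [b [g ->]]]]].
    rewrite inE => g ->; rewrite set21; split=> //.
    by apply/edgesP; exists v, w.
  rewrite !inE => /orP[]/eqP->; first by exists b; rewrite ?inE.
  by exists a; rewrite ?inE 1?adj_sym // setUC.
under eq_bigr do rewrite degE.
rewrite exchange_big /= mulnC -sum_nat_const; apply: eq_bigr => e.
case/edgesP=> a [b [g ->]]; rewrite -big_mkcond sum1_card /= cards2.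
by case: eqP g => // ->; rewrite adj_irr.
Qed.

Hypothesis deg_ge2 : forall v, 2 <= #|nbrs G v|.

(** As degrees are at least 2, the truncated subtraction is exact. The total excess of the degrees
    over 2 is thus 0 for n edges and 2 for n + 1 edges. *)
Lemma excess : \sum_v (#|nbrs G v| - 2) + 2 * #|T| = 2 * #|edges G|.
Proof.
rewrite -handshake mulnC -sum_nat_const -big_split /=.
by apply: eq_bigr => v _; rewrite subnK.
Qed.

Lemma card_edges_ge : #|T| <= #|edges G|.
Proof. by have := excess; lia. Qed.

Lemma deg_cycle : #|edges G| <= #|T| -> forall v, #|nbrs G v| = 2.
Proof.
move=> le v; have E : \sum_v (#|nbrs G v| - 2) = 0 by have := excess; lia.
move/eqP: E; rewrite sum_nat_eq0 => /forallP/(_ v)/=.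
by have := deg_ge2 v; lia.
Qed.

Lemma deg_theta : #|edges G| = #|T|.+1 ->
  exists x, (#|nbrs G x| = 4 /\ forall v, v != x -> #|nbrs G v| = 2) \/
  exists y, [/\ x != y, #|nbrs G x| = 3, #|nbrs G y| = 3 &
     forall v, v != x -> v != y -> #|nbrs G v| = 2].
Proof.
move=> eE; have E : \sum_v (#|nbrs G v| - 2) = 2 by have := excess; lia.
have [x x3] : exists x, 2 < #|nbrs G x|.
  apply/existsP; case: (boolP [exists _, _]) => // /existsPn H; move: E.
  by rewrite big1 // => v _; have := H v; lia.
exists x; have [lt4|gt3] := leqP #|nbrs G x| 3; [right|left]; last first.
  move: E; rewrite (bigD1 x) //= => E.
  have : \sum_(i | i != x) (#|nbrs G i| - 2) == 0 by lia.
  rewrite sum_nat_eq0 => /forallP H; split; last first.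
    by move=> v vx; have := H v; have := deg_ge2 v; rewrite vx /=; lia.
  by move: E; rewrite big1; [lia|move=> v vx; have := H v; rewrite vx /=; lia].
move: E; rewrite (bigD1 x) //= => E.
have : \sum_(i | i != x) (#|nbrs G i| - 2) == 1 by lia.
case/sum_nat_eq1 => y [yx y3 H]; exists y; split; try lia.
  by rewrite eq_sym.
move=> v vx vy; have Hv : #|nbrs G v| - 2 = 0 by apply: H.
by have := deg_ge2 v; lia.
Qed.

End Degrees.

(** * Degrees and edges in rainbow 2-connected graphs *)

Section LowerBound.
Variables (T : finType) (G : sgraph T) (c : {set T} -> nat).
Implicit Types (u v x y z : T) (p q : seq T) (A B C : seq T).
Hypothesis rc : rainbow_2connected G c.

Lemma rainbow_paths u v : u != v -> exists p q,
  [/\ disjoint_paths G u v p q, rainbow c u p & rainbow c u q].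
Proof.
move=> uv; have [p [q [/andP[P rp] /andP[Q rq] n D]]] := rc uv.
by exists p, q.
Qed.

(** Of two internally disjoint paths at most one passes through z. *)
Lemma rainbow_path_avoid u v z : u != v -> z != v ->
  exists p, [/\ is_path G u v p, rainbow c u p & z \notin p].
Proof.
move=> uv zv; have [p [q [D rp rq]]] := rainbow_paths uv.
case: (D) => P Q _ _.
by case/orP: (disjoint_paths_avoid D zv) => zn; [exists p|exists q].
Qed.

Lemma rainbow_deg_ge2 v : 1 < #|T| -> 2 <= #|nbrs G v|.
Proof.
case/card_gt1P=> a [b [_ _ ab]].
have [u vu] : exists u, v != u.
  by case: (eqVneq v a) => [->|]; [exists b|exists a].
have [p [q [D _ _]]] := rainbow_paths vu.
have [d [p' [e [q' [_ _ de gd ge]]]]] := disjoint_paths_head vu D.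
by apply/card_gt1P; exists d, e; rewrite !inE.
Qed.

(** The two paths from z to w start with different vertices, so one of them does not start with w.
    It never returns to z and hence avoids the edge between z and w. *)
Lemma rainbow_edge_path z w : #|nbrs G z| = 2 -> G z w -> z != w ->
  exists q, [/\ is_path G z w q, rainbow c z q & [set z; w] \notin path_edges z q].
Proof.
move=> d2 g zw; have [p [q [D rp rq]]] := rainbow_paths zw.
have [a [p' [b [q' [Ep Eq ab ga gb]]]]] := disjoint_paths_head zw D.
have aux r t r' : is_path G z w r -> r = t :: r' -> t != w ->
    [set z; w] \notin path_edges z r.
  move=> /and3P[_ _ /andP[zr _]] E tw; rewrite E /= inE negb_or.
  rewrite (contra_neqN _ tw); last by move/eqP/set2_inj.
  apply/negP=> /mem_path_edges/(_ (set21 _ _)).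
  by rewrite -E (negPf zr).
case: D => P Q _ _; case: (eqVneq a w) => aw; last by exists p; split=> //; apply: aux Ep aw.
by exists q; split=> //; apply: aux Eq _ => //; rewrite -aw eq_sym.
Qed.

Lemma through_edge u v p z a b : is_path G u v p -> z != u -> z != v ->
  #|nbrs G z| = 2 -> G z b ->
  [set z; a] \in path_edges u p -> [set z; b] \in path_edges u p.
Proof.
move=> P zu zv d2 gb /mem_path_edges/(_ (set21 _ _)).
by rewrite inE (negPf zu) /= => zp; apply: inner_saturated P zp zv d2 gb.
Qed.

Lemma uniq_colours (L L' : seq {set T}) : uniq (map c L) -> {subset L' <= L} ->
  uniq L' -> uniq (map c L').
Proof.
move=> U S U'; rewrite map_inj_in_uniq // => e f /S e1 /S f1.
exact: (uniq_map_inj_in U).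
Qed.

Lemma path_closed (S : pred T) u p :
  (forall a b, S a -> b \in p -> G a b -> S b) -> path G u p -> S u ->
  S (last u p).
Proof.
elim: p u => [|a p IH] u //= cl /andP[ua pp] Su.
apply: IH => //; last by apply: cl Su _ ua; rewrite inE eqxx.
by move=> d e Sd ep; apply: cl => //; rewrite inE ep orbT.
Qed.

(** Every vertex other than v is reached from u by a path avoiding v, along which S persists. Every
    edge has an endpoint other than v, so it lies in L. Nothing is asked of the edges at v, where a
    degree may be unknown. *)
Lemma all_edges (S : pred T) (L : seq {set T}) u v : u != v -> S u ->
  (forall a b, S a -> a != v -> G a b -> [set a; b] \in L /\ S b) ->
  forall a b, G a b -> [set a; b] \in L.
Proof.
move=> uv Su cl.
have SV a : a != v -> S a.
  move=> av; case: (eqVneq u a) => [<- //|ua].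
  have [|p [/and3P[pp /eqP <- _] _ vp]] := @rainbow_path_avoid u a v ua.
    by rewrite eq_sym.
  suff : [predI S & predC1 v] (last u p) by case/andP.
  apply: path_closed pp _; last by apply/andP.
  move=> d e /andP[Sd dv] ep g; have [_ Se] := cl _ _ Sd dv g.
  by apply/andP; split=> //; apply: contraNneq vp => <-.
move=> a b g; case: (eqVneq a v) => av; last by case: (cl _ _ (SV _ av) av g).
rewrite setUC; have bv : b != v.
  by apply: contraTneq g => ->; rewrite av adj_irr.
by rewrite adj_sym in g; case: (cl _ _ (SV _ bv) bv g).
Qed.

(** The two paths use up both edges at each of their vertices other than v, so nothing can branch
    off. *)
Lemma disjoint_paths_edges u v p q : disjoint_paths G u v p q -> u != v ->
  (forall z, z != v -> #|nbrs G z| = 2) ->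
  forall a b, G a b -> [set a; b] \in path_edges u p ++ path_edges u q.
Proof.
move=> D uv d2.
apply: (@all_edges [pred z | (z \in u :: p) || (z \in u :: q)] _ u v uv).
  by rewrite /= mem_head.
move=> a b Sa av g.
have H : [set a; b] \in path_edges u p ++ path_edges u q.
  case: (D) => P Q _ _; rewrite mem_cat.
  move: Sa; rewrite /= !inE; case: (eqVneq a u) => [au _|_] /=.
    subst a; have [d [p' [e [q' [-> -> de gd ge]]]]] := disjoint_paths_head uv D.
    by case/orP: (nbrs2 (d2 _ uv) de gd ge g) => /eqP->; rewrite /= !inE eqxx ?orbT.
  by case/orP=> ap; rewrite (inner_saturated _ ap av (d2 _ av) g) ?orbT.
split=> //; move: H; rewrite mem_cat /=.
by case/orP=> /mem_path_edges/(_ (set22 _ _)) ->; rewrite ?orbT.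
Qed.

Lemma edge_at_last u v p b : is_path G u v (rcons p v) ->
  [set v; b] \in path_edges u (rcons p v) -> b = last u p.
Proof.
case/and3P=> _ _; rewrite -rcons_cons rcons_uniq => /andP[vp _].
rewrite path_edges_rcons mem_rcons inE => /orP[/eqP|].
  by rewrite (setUC [set last u p]) => /set2_inj.
by move/mem_path_edges/(_ (set21 _ _)); rewrite (negPf vp).
Qed.

Lemma edge_at_head u p b : u \notin p -> [set u; b] \in path_edges u p ->
  b = head u p.
Proof.
case: p => [|a p] //= up; rewrite inE => /orP[/eqP/set2_inj//|].
by move/mem_path_edges/(_ (set21 _ _)); rewrite (negPf up).
Qed.

Lemma is_path_rcons u v p : u != v -> is_path G u v p ->
  exists p', p = rcons p' v.
Proof.
move=> uv /and3P[_ /eqP lp _]; subst v; case/lastP: p uv => [|p w] /=; first by rewrite eqxx.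
by rewrite last_rcons => _; exists p.
Qed.

(** Two disjoint paths ending in x would contain all edges, but they enter x by only two edges. *)
Lemma no_deg4 x : 1 < #|T| -> #|nbrs G x| = 4 ->
  ~ (forall v, v != x -> #|nbrs G v| = 2).
Proof.
case/card_gt1P=> a [b [_ _ ab]] d4 d2.
have [y yx] : exists y, y != x.
  by case: (eqVneq a x) => [<-|]; [exists b; rewrite eq_sym|exists a].
have [p [q [D _ _]]] := rainbow_paths yx.
have E := disjoint_paths_edges D yx d2; case: D => P Q _ _.
have [p' Ep] := is_path_rcons yx P; have [q' Eq] := is_path_rcons yx Q.
subst p q.
suff /subset_leq_card : nbrs G x \subset [set last y p'; last y q'].
  by rewrite d4 cards2; case: eqP.
apply/subsetP=> w; rewrite !inE => /E; rewrite mem_cat.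
by case/orP=> [/(edge_at_last P)|/(edge_at_last Q)] ->; rewrite eqxx ?orbT.
Qed.

(** Let g be a third edge, with ends u and v. As u has degree 2, one of the two paths from u to v is
    g itself; the other is rainbow and contains all remaining edges, so two of these cannot share a
    colour. *)
Lemma rainbow_cycle : (forall v, #|nbrs G v| = 2) -> 2 < #|edges G| ->
  {in edges G &, injective c}.
Proof.
move=> d2 E3 e f eE fE ef.
apply/eqP; apply: contraLR E3 => nef.
(* By contraposition: if e and f differ, no third edge exists, so there are at most two edges. *)
rewrite -leqNgt (cardsD1 e) (cardsD1 f) eE !inE eq_sym nef fE /= !add1n !ltnS.
rewrite leqn0 cards_eq0; apply/eqP/setP => g; rewrite !inE.
apply/negP => /and3P[gf ge /edgesP[u [v [uv Eg]]]].
have nuv : u != v by apply: contraTneq uv => ->; rewrite adj_irr.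
have [p [q [D rp rq]]] := rainbow_paths nuv.
have short p1 q1 : disjoint_paths G u v p1 q1 -> rainbow c u q1 ->
    head u p1 = v -> False.
  move=> D1 r1 h1; have EE := disjoint_paths_edges D1 nuv (fun z _ => d2 z).
  have p1E : path_edges u p1 = [:: g].
    case: D1 => /and3P[_ l1 /andP[_ U1]] _ _ _; move: h1 l1 U1.
    case: p1 {EE} => [|a [|b p1]] /= h1; subst; rewrite ?eqxx //.
      by rewrite eqxx in nuv.
    by move=> /eqP <-; rewrite mem_last.
  have inq h : h \in edges G -> g != h -> h \in path_edges u q1.
    case/edgesP=> a [b [ab ->]]; have := EE _ _ ab.
    by rewrite p1E mem_cat inE eq_sym => /orP[->|].
  move/negP: nef; apply; apply/eqP.
  by apply: (uniq_map_inj_in r1) => //; apply: inq.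
have [a [p' [b [q' [Ep Eq ab ga gb]]]]] := disjoint_paths_head nuv D.
case/orP: (nbrs2 (d2 u) ab ga gb uv) => /eqP E.
  by apply: (short _ _ D) => //; rewrite Ep.
by apply: (short _ _ (disjoint_pathsC D)) => //; rewrite Eq.
Qed.

End LowerBound.

(** * Theta graphs *)

Section Theta.
Variables (T : finType) (G : sgraph T).
Implicit Types (u v x y z : T) (p q : seq T) (A B C : seq T).

(** [A] lists only the inner vertices, so the empty list encodes the single edge from x to y. *)
Definition thread x y A := path_edges x (rcons A y).

(** [theta_nil] says that at most one thread is a single edge, as it must be in a simple graph. *)
Record theta x y A B C : Prop := Theta {
  theta_path1 : is_path G x y (rcons A y);
  theta_path2 : is_path G x y (rcons B y);
  theta_path3 : is_path G x y (rcons C y);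
  theta_uniq : uniq (A ++ B ++ C);
  theta_deg : forall z, z \in A ++ B ++ C -> #|nbrs G z| = 2;
  theta_edges : forall a b, G a b ->
    [set a; b] \in thread x y A ++ thread x y B ++ thread x y C;
  theta_nil : 2 <= (A != [::]) + (B != [::]) + (C != [::])
}.

(** Together with the rotation below, this generates all permutations of the threads, so later
    statements may single out particular threads. *)
Lemma theta_swap x y A B C : theta x y A B C -> theta x y B A C.
Proof.
case=> pA pB pC U d E n; split=> //.
- by rewrite uniq_catCA.
- by move=> z zi; apply: d; move: zi; rewrite !mem_cat orbCA.
- by move=> a b /E; rewrite !mem_cat orbCA.
by rewrite (addnC (B != _)).
Qed.

Lemma theta_rot x y A B C : theta x y A B C -> theta x y B C A.
Proof.
case=> pA pB pC U d E n; split=> //.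
- by rewrite catA uniq_catC.
- by move=> z zi; apply: d; move: zi; rewrite !mem_cat orbA orbC.
- by move=> a b /E; rewrite !mem_cat orbC orbA.
by rewrite addnC addnA.
Qed.

Lemma thread_rev x y A : thread y x (rev A) = rev (thread x y A).
Proof.
rewrite /thread -path_edges_rev last_rcons belast_rcons rev_cons.
by [].
Qed.

(** Transfers every statement about the edges at x to the edges at y. *)
Lemma theta_rev x y A B C :
  theta x y A B C -> theta y x (rev A) (rev B) (rev C).
Proof.
have R D : is_path G x y (rcons D y) -> is_path G y x (rcons (rev D) x).
  by move/is_path_rev; rewrite belast_rcons rev_cons.
have N D : (rev D != [::]) = (D != [::] :> seq T).
  by rewrite -!size_eq0 size_rev.
case=> pA pB pC U d E n; split; try exact: R.
- by rewrite -!rev_cat rev_uniq uniq_catC uniq_catCA uniq_catC -catA.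
- by move=> z zi; apply: d; move: zi; rewrite !mem_cat !mem_rev.
- by move=> a b /E; rewrite !thread_rev !mem_cat !mem_rev.
by rewrite !N.
Qed.

Lemma theta_card x y A B C : theta x y A B C ->
  #|edges G| <= size (thread x y A ++ thread x y B ++ thread x y C).
Proof.
case=> _ _ _ _ _ E _; apply: leq_trans (card_size _).
by apply/subset_leq_card/subsetP => e /edgesP[a [b [/E H ->]]].
Qed.

(* An edge common to two threads would have an inner vertex of the first one
   as an endpoint, unless the first one is a single edge. *)
Lemma thread_disjoint x y A B e : uniq (x :: rcons A y) ->
  ~~ has (mem A) B -> A != [::] -> e \in thread x y A -> e \notin thread x y B.
Proof.
move=> U D A0 eA; apply/negP => eB.
have [z zA ze] : exists2 z, z \in A & z \in e.
  have [p1 [z [p2 [Ep ->]]]] := path_edges_split eA.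
  case/lastP: p2 Ep => [|p2 w]; last first.
    rewrite -rcons_cons -rcons_cat => /rcons_inj[-> _].
    by exists z; rewrite ?set22 // mem_cat mem_head orbT.
  rewrite cats1 => /rcons_inj[E _]; subst p1.
  exists (last x A); rewrite ?set21 //.
  by case: A A0 {eA U D} => //= a A _; rewrite mem_last.
have := mem_path_edges eB ze; rewrite inE mem_rcons inE.
move: U; rewrite cons_uniq rcons_uniq mem_rcons inE negb_or => /and3P[/andP[_ xA] yA _].
case: (eqVneq z x) => [E|_]; first by rewrite -E zA in xA.
case: (eqVneq z y) => [E|_] /=; first by rewrite -E zA in yA.
by move=> zB; case/negP: D; apply/hasP; exists z.
Qed.

Lemma theta_thread_uniq x y A B C : theta x y A B C -> A != [::] ->
  uniq (thread x y A ++ thread x y B).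
Proof.
case=> /and3P[_ _ pA] /and3P[_ _ pB] _ U _ _ _ A0.
rewrite cat_uniq !uniq_path_edges //= andbT; apply/hasPn => e eB /=.
apply/negP=> eA; have D : ~~ has (mem A) B.
  by move: U; rewrite catA cat_uniq => /andP[]; rewrite cat_uniq => /and3P[].
by have := thread_disjoint pA D A0 eA; rewrite eB.
Qed.

Variable c : {set T} -> nat.
Hypothesis rc : rainbow_2connected G c.

(* A path from u to v that avoids x runs through both threads to y. *)
Lemma theta_behead x y u v A B C : theta x y (u :: A) (v :: B) C ->
  uniq (behead (map c (thread x y (u :: A))) ++
        behead (map c (thread x y (v :: B)))).
Proof.
move=> th; rewrite /= -map_cat -/(thread u y A) -/(thread v y B).
have U := theta_uniq th.
have uvn : u != v.
  by apply: contraTneq U => ->; rewrite /= mem_cat inE eqxx orbT.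
have xin w D : is_path G x y (rcons (w :: D) y) -> x != w.
  by case/and3P=> _ _ /=; rewrite inE negb_or => /andP[/andP[]].
have xu := xin _ _ (theta_path1 th); have xv := xin _ _ (theta_path2 th).
have [q [Q rq xq]] := rainbow_path_avoid rc uvn xv.
(* [main] serves both threads: w is u or v and D is the rest of its thread. Once the path takes an
   edge at w, degree 2 carries it along D to y. *)
have main w D (E : seq T) t : is_path G x y (rcons (w :: D) y) ->
    uniq (w :: D) -> x != w ->
    (forall z, z \in w :: D -> #|nbrs G z| = 2) ->
    {subset D <= E} -> u \notin E -> v \notin E ->
    G w t -> [set w; t] \in path_edges u q ->
    {subset thread w y D <= path_edges u q}.
  move=> P UD xw d2 DE uE vE g tq.
  have tx : t != x.
    apply: contraTneq tq => ->; apply/negP => /mem_path_edges/(_ (set22 _ _)).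
    by rewrite inE (negPf xu) (negPf xq).
  have wy : w != y.
    case/and3P: P => _ _ /= /and3P[_ H _].
    by apply: contraNneq H => ->; rewrite mem_rcons mem_head.
  apply/allP; apply: (@path_edges_all _ G).
  - by case/and3P: P => /andP[].
  - move=> z; rewrite /inner belast_rcons /= => zD a b _ gb; apply: (through_edge Q) => //.
    + by apply: contraNneq uE => <-; apply: DE.
    + by apply: contraNneq vE => <-; apply: DE.
    + by apply: d2; rewrite inE zD orbT.
  (* The two edges at w lead to x and to the next vertex of the thread; the path avoids x, so it
     takes the second. *)
  apply/hasP; exists [set w; t] => //.
  have : [set w; t] \in thread x y (w :: D).
    apply: inner_saturated P _ wy (d2 _ _) g; first by rewrite mem_head.
    by rewrite mem_head.
  rewrite /thread /= inE => /orP[/eqP|//].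
  by rewrite (setUC [set x]) => /set2_inj E1; rewrite E1 eqxx in tx.
have [[t gt tq] [s gs sq]] := edge_at_end Q uvn.
apply: uniq_colours rq _ _.
  move=> e; rewrite mem_cat => /orP[]; move: e.
    apply: (main u A A t (theta_path1 th)) => //.
    - by move: U; rewrite cat_uniq => /and3P[].
    - by move=> z zi; apply: (theta_deg th); rewrite mem_cat zi.
    - by move: U; rewrite cat_cons cons_uniq mem_cat negb_or => /andP[/andP[]].
    - move: U; rewrite uniq_catCA cat_cons cons_uniq !mem_cat !inE !negb_or.
      by case/andP=> /andP[_ /andP[/andP[_ ->]]].
  apply: (main v B B s (theta_path2 th)) => //.
  - by move: U; rewrite uniq_catCA cat_uniq => /and3P[].
  - by move=> z zi; apply: (theta_deg th); rewrite !mem_cat zi orbT.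
  - by move: U; rewrite cat_cons cons_uniq !mem_cat !inE !negb_or
      => /andP[/andP[_ /andP[/andP[_ ->]]]].
  - by move: U; rewrite uniq_catCA cat_cons cons_uniq mem_cat negb_or => /andP[/andP[]].
have := theta_thread_uniq th isT; rewrite {1}/thread /= -/(thread u y A).
case/andP=> _; apply: subseq_uniq; rewrite /thread /=.
by apply: cat_subseq => //; apply: subseq_cons.
Qed.

(* The rainbow path closing a cycle with the edge from last x p1 to b follows
   the remainder of the first thread and then one of the two others. *)
Lemma theta_edge x y A B C p1 b p2 : theta x y A B C -> A != [::] ->
  rcons A y = p1 ++ b :: p2 ->
  uniq (map c ((path_edges x p1 ++ path_edges b p2) ++ thread x y B)) ||
  uniq (map c ((path_edges x p1 ++ path_edges b p2) ++ thread x y C)).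
Proof.
move=> th A0 EA; set es := _ ++ path_edges b p2; pose a := last x p1.
have P := theta_path1 th; have U := theta_uniq th.
have [pp _ Up] := and3P P.
have thE : thread x y A = path_edges x p1 ++ [set a; b] :: path_edges b p2.
  by rewrite /thread EA path_edges_cat.
have lasty : last b p2 = y.
  by have := last_rcons x A y; rewrite EA last_cat.
have mA z : (z \in rcons A y) && (z != y) = (z \in A).
  rewrite mem_rcons inE; case: (eqVneq z y) => [->|] /=; rewrite ?andbT //.
  by move: Up; rewrite cons_uniq rcons_uniq => /and3P[_ /negPf->].
have dA z : z \in A -> #|nbrs G z| = 2.
  by move=> zA; apply: (theta_deg th); rewrite mem_cat zA.
have xA : x \notin A.
  by move: Up; rewrite cons_uniq mem_rcons inE negb_or => /andP[/andP[]].
have Ucat : uniq ((x :: p1) ++ b :: p2) by rewrite cat_cons -EA.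
have ab : G a b by move: pp; rewrite EA cat_path => /and3P[].
have aP : a \notin b :: p2.
  move: Ucat; rewrite cat_uniq => /and3P[_ /hasPn H _]; apply/negP=> /H.
  by rewrite /= mem_last.
have bP : b \notin x :: p1.
  by move: Ucat; rewrite cat_uniq => /and3P[_ /hasPn H _]; apply: H; rewrite mem_head.
have nab : a != b by apply: contraNneq aP => ->; rewrite mem_head.
have p1A : {subset p1 <= A}.
  move=> t tp; rewrite -mA EA mem_cat tp /=; apply: contraTneq Ucat => ty.
  rewrite cat_uniq andbCA; apply/nandP; left; rewrite negbK.
  apply/hasP; exists t; first by rewrite ty -lasty mem_last.
  by rewrite /= inE tp orbT.
have aA : p1 != [::] -> a \in A.
  by rewrite /a => p10; apply: p1A; case: (p1) p10 => //= d p3 _; rewrite mem_last.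
have p2A : {subset belast b p2 <= A}.
  move=> t tp; rewrite -mA EA mem_cat lastI lasty mem_rcons inE tp !orbT /=.
  move: Ucat; rewrite cat_uniq => /and3P[_ _].
  by rewrite lastI lasty rcons_uniq => /andP[H _]; apply: contraNneq H => <-.
have bA : p2 != [::] -> b \in A.
  by move=> p20; apply: p2A; case: (p2) p20 => // d p3 _; rewrite mem_head.
(* As [A] is nonempty, a or b is an inner vertex of the thread. The path starts at such an end, so z
   and w are a and b in one of the two orders. *)
have [z [w [q [Ezw zw Q rq nq]]]] : exists z w q, [/\ [set z; w] = [set a; b], z != w,
    is_path G z w q, rainbow c z q & [set a; b] \notin path_edges z q].
  have : (p1 != [::]) || (p2 != [::]).
    move: EA A0; case: (p1) => //; case: (p2) => //=.
    by case: (A) => // d [|].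
  case/orP=> [/aA/dA d2|/bA/dA d2].
    have [q [Q rq nq]] := rainbow_edge_path rc d2 ab nab.
    by exists a, b, q.
  rewrite adj_sym in ab; rewrite eq_sym in nab.
  have [q [Q rq nq]] := rainbow_edge_path rc d2 ab nab.
  by exists b, a, q; rewrite (setUC [set a]).
have notend t : t != a -> t != b -> (t != z) && (t != w).
  by case/set2_eq: Ezw => [] [-> ->] -> ->.
set F := mem (path_edges z q).
have thr t d e : t != a -> t != b -> #|nbrs G t| = 2 -> G t e ->
    [set t; d] \in F -> [set t; e] \in F.
  move=> ta tb d2 ge; have /andP[tz tw] := notend t ta tb.
  exact: (through_edge Q).
have [aF bF] : (exists2 t, G a t & [set a; t] \in F) /\
               (exists2 t, G b t & [set b; t] \in F).
  have [H1 H2] := edge_at_end Q zw.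
  by case/set2_eq: Ezw => -[<- <-]; split.
have nab' t : [set a; t] \in F -> t != b by apply: contraTneq => ->.
have nba' t : [set b; t] \in F -> t != a.
  by apply: contraTneq => ->; rewrite setUC.
(* The path leaves a by an edge other than the one to b, hence towards x, and must follow the thread
   up to x. The part from b to y is symmetric. *)
have all1 : {subset path_edges x p1 <= F}.
  case: (eqVneq p1 [::]) => [->//|p10].
  apply/allP; apply: (@path_edges_all _ G).
  - by move: pp; rewrite EA cat_path => /andP[].
  - move=> t ti d e _ ge.
    have [tp1 ta] : t \in p1 /\ t != a.
      move: ti Ucat; rewrite /a /inner; case/lastP: (p1) => // p3 a'.
      rewrite belast_rcons last_rcons /= => tp; rewrite mem_rcons inE tp orbT.
      rewrite cat_uniq rcons_uniq -andbA => /and3P[_ H _]; split=> //.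
      by apply: contraNneq H => <-.
    apply: thr => //; last exact/dA/p1A.
    by apply: contraNneq bP => <-; rewrite inE tp1 orbT.
  case: aF => t gt tF; apply/hasP; exists [set a; t] => //.
  have : [set a; t] \in thread x y A.
    have /andP[aR ay] : (a \in rcons A y) && (a != y) by rewrite mA aA.
    exact: inner_saturated P aR ay (dA _ (aA p10)) gt.
  rewrite thE mem_cat inE => /or3P[//|/eqP/set2_inj E|].
    by have := nab' _ tF; rewrite E eqxx.
  by move/mem_path_edges/(_ (set21 _ _)); rewrite (negPf aP).
have all2 : {subset path_edges b p2 <= F}.
  case: (eqVneq p2 [::]) => [->//|p20].
  apply/allP; apply: (@path_edges_all _ G).
  - by move: pp; rewrite EA cat_path => /and3P[].
  - move=> t ti d e _ ge.
    have tp2 : t \in belast b p2 by apply: mem_behead.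
    apply: thr => //; last exact/dA/p2A.
      by apply: contraNneq aP => <-; apply: mem_belast.
    move: Ucat ti; rewrite cat_uniq /inner => /and3P[_ _].
    rewrite lastI rcons_uniq; case: (p2) p20 => // d' p3 _ /= /and3P[_ H _] tp.
    by apply: contraNneq H => <-.
  case: bF => t gt tF; apply/hasP; exists [set b; t] => //.
  have : [set b; t] \in thread x y A.
    have /andP[bR bY] : (b \in rcons A y) && (b != y) by rewrite mA bA.
    exact: inner_saturated P bR bY (dA _ (bA p20)) gt.
  rewrite thE mem_cat inE => /or3P[|/eqP|//].
    by move/mem_path_edges/(_ (set21 _ _)); rewrite (negPf bP).
  rewrite (setUC [set a]) => /set2_inj E.
  by have := nba' _ tF; rewrite E eqxx.
have hd t : [set x; t] \in thread x y A -> t = head x (p1 ++ b :: p2).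
  by rewrite -EA; apply: edge_at_head; move: Up; rewrite cons_uniq => /andP[].
(* At x the path enters another thread. If [p1] is empty, then a is x and the path uses an edge at x
   other than the one to b; otherwise x is inner to the path, and only one of its two path edges is
   in the first thread. *)
have hasF : has F (thread x y B ++ thread x y C).
  have [t tF tn] : exists2 t, [set x; t] \in F & t != head x (p1 ++ b :: p2).
    case: (eqVneq p1 [::]) => [p10|p10].
      case: aF => t _; rewrite /a p10 /= => tF; exists t => //.
      by apply: nab'; rewrite /a p10.
    have ax : x != a by apply: contraNneq xA => ->; apply: aA.
    have bx : x != b by apply: contraNneq bP => <-; rewrite mem_head.
    have /andP[xz xw] := notend x ax bx.
    have xh : [set x; head x (p1 ++ b :: p2)] \in F.
      by apply: all1; case: (p1) p10 => // d p3 _; rewrite /= inE eqxx.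
    have xq : x \in q.
      by have := mem_path_edges xh (set21 _ _); rewrite inE (negPf xz).
    have [b1 [b2 [n12 _ _ f1 f2]]] := inner_two Q xq xw.
    case: (eqVneq b1 (head x (p1 ++ b :: p2))) => E; last by exists b1.
    by exists b2; rewrite // -E eq_sym.
  have gt : G x t by case/and3P: Q => pq _ _; apply: path_edges_adj pq tF.
  apply/hasP; exists [set x; t] => //.
  have := theta_edges th gt; rewrite mem_cat => /orP[/hd E|//].
  by rewrite E eqxx in tn.
(* One edge of the thread through D on the path brings the whole thread along, so all listed edges
   lie on one rainbow path. *)
have fin D E : theta x y A D E -> has F (thread x y D) ->
    uniq (map c (es ++ thread x y D)).
  move=> thD hD; apply: uniq_colours rq _ _; last first.
    apply: subseq_uniq (theta_thread_uniq thD A0); apply: cat_subseq => //.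
    by rewrite thE; apply: cat_subseq => //; apply: subseq_cons.
  move=> e; rewrite !mem_cat -orbA => /or3P[/all1|/all2|] //; move: e.
  have PD := theta_path2 thD.
  apply/allP; apply: (@path_edges_all _ G) hD; first by case/and3P: PD.
  move=> t; rewrite /inner belast_rcons /= => tD d e _ ge.
  have [tx ty] : t != x /\ t != y.
    case/and3P: PD => _ _; rewrite cons_uniq rcons_uniq mem_rcons inE negb_or.
    by case/and3P=> [/andP[_ xD] yD _]; split; apply: contraTneq tD => ->.
  have tA : t \notin A.
    apply/negP=> tA; have := theta_uniq thD; rewrite cat_uniq => /and3P[_ /hasPn H _].
    by have := H t; rewrite mem_cat tD /= tA => /(_ isT).
  apply: thr ge.
  - apply: contraNneq tA => ta; rewrite ta; apply: aA.
    by apply: contraNneq tx => p10; rewrite ta /a p10.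
  - apply: contraNneq tA => tb; rewrite tb; apply: bA.
    by apply: contraNneq ty => p20; rewrite tb -lasty p20.
  by apply: (theta_deg thD); rewrite !mem_cat tD orbT.
move: hasF; rewrite has_cat => /orP[hB|hC]; apply/orP.
  by left; apply: fin th hB.
by right; apply: fin (theta_rot (theta_swap th)) hC.
Qed.
End Theta.

(** * Colour sequences of three threads *)

Section ColourLists.
Variable K : eqType.
Implicit Types (a b c s t : seq K) (k l h g : K).

(** Reads the condition at y, obtained on reversed threads, as dropping last entries instead of
    first ones. *)
Lemma uniq_behead_rev s t k l :
  uniq (behead (rev (rcons s k)) ++ behead (rev (rcons t l))) = uniq (s ++ t).
Proof. by rewrite !rev_rcons /= uniq_catC -rev_cat rev_uniq. Qed.

Lemma uniq_cat3 a b c : uniq (a ++ b) -> uniq (b ++ c) -> uniq (a ++ c) ->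
  uniq (a ++ b ++ c).
Proof.
rewrite !cat_uniq has_cat => /and3P[-> n1 ->] /and3P[_ n2 ->] /and3P[_ n3 _].
by rewrite (negPf n1) (negPf n2) (negPf n3).
Qed.

Lemma uniq_cover s t : uniq s -> {subset s <= t} -> size t <= size s ->
  {subset t <= s}.
Proof. by move=> U S le; have [_ E] := uniq_min_size U S le; move=> z; rewrite E. Qed.

Lemma uniq_cons_cat k s t : uniq ((k :: s) ++ t) -> k \notin s /\ k \notin t.
Proof. by rewrite cat_cons cons_uniq mem_cat negb_or => /andP[/andP[]]. Qed.

(** Here a, b, c are the colour sequences of the threads, with first colours [ha], [hb], [hc] and
    last colours [la], [lb], [lc], and t lists the available colours. The first three hypotheses
    come from x, the next three from y, and the disjunction from the rainbow path closing a cycle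
    with the edge coloured g. *)
Lemma colours_long ha hb hc la lb lc g ma mb mc t :
  let a := ha :: g :: rcons ma la in
  let b := hb :: rcons mb lb in
  let c := hc :: rcons mc lc in
  uniq (behead a ++ behead b) -> uniq (behead b ++ behead c) ->
  uniq (behead a ++ behead c) ->
  uniq ((ha :: g :: ma) ++ hb :: mb) -> uniq ((hb :: mb) ++ hc :: mc) ->
  uniq ((ha :: g :: ma) ++ hc :: mc) ->
  uniq (ha :: rcons ma la ++ b) || uniq (ha :: rcons ma la ++ c) ->
  {subset a ++ b ++ c <= t} -> size t + 3 <= size (a ++ b ++ c) -> False.
Proof.
move=> a b c U1 U2 U3 V1 V2 V3 E S sz.
(* The edges away from x have distinct colours and are at least as many as the colours in t, so
   every colour occurs among them. *)
have M : {subset t <= behead a ++ behead b ++ behead c}.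
  apply: uniq_cover; first exact: uniq_cat3.
    by move=> z zi; apply: S; move: zi; rewrite !mem_cat => /or3P[] /mem_behead->; rewrite ?orbT.
  by move: sz; rewrite !size_cat !size_behead /=; lia.
(* A first colour reappears away from x. The conditions at y keep it off the middle edges, so it is
   one of the last colours. *)
have ends h : h \in a ++ b ++ c -> h \notin g :: ma -> h \notin mb ->
    h \notin mc -> h \in [:: la; lb; lc].
  move=> /S/M; rewrite !mem_cat -[behead a]/(rcons (g :: ma) la) !mem_rcons !in_cons.
  by move=> H /norP[/negPf n1 /negPf n2] /negPf n3 /negPf n4; move: H; rewrite n1 n2 n3 n4 !orbF /= orbA.
have dis s s' z : uniq (s ++ s') -> z \in s -> z \notin s'.
  by rewrite cat_uniq => /and3P[_ /hasPn H _] zs; apply/negP=> /H; rewrite /= zs.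
have Ea : ha \in [:: la; lb; lc].
  apply: ends; first by rewrite mem_cat mem_head.
  - by case: (uniq_cons_cat V1).
  - by have := dis _ _ ha V1 (mem_head _ _); rewrite inE negb_or => /andP[].
  - by have := dis _ _ ha V3 (mem_head _ _); rewrite inE negb_or => /andP[].
have Eb : hb \in [:: la; lb; lc].
  apply: ends; first by rewrite !mem_cat mem_head orbT.
  - move: V1; rewrite uniq_catC => V1.
    by have := dis _ _ hb V1 (mem_head _ _); rewrite inE negb_or => /andP[].
  - by case: (uniq_cons_cat V2).
  - by have := dis _ _ hb V2 (mem_head _ _); rewrite inE negb_or => /andP[].
have Ec : hc \in [:: la; lb; lc].
  apply: ends; first by rewrite !mem_cat mem_head !orbT.
  - move: V3; rewrite uniq_catC => V3.
    by have := dis _ _ hc V3 (mem_head _ _); rewrite inE negb_or => /andP[].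
  - move: V2; rewrite uniq_catC => V2.
    by have := dis _ _ hc V2 (mem_head _ _); rewrite inE negb_or => /andP[].
  - by move: V3; rewrite uniq_catC => /uniq_cons_cat[].
have far h l m : uniq (ha :: rcons ma la ++ h :: rcons m l) ->
    [/\ ha != la, ha != h, ha != l, la != h & h != l].
  rewrite -cat_cons => W; have := W; rewrite cat_uniq => /and3P[/andP[A1 _] _ /andP[B1 _]].
  have := dis _ _ ha W (mem_head _ _); have := dis _ _ la W.
  rewrite !inE !mem_rcons !inE eqxx !orbT => /(_ isT).
  rewrite !negb_or => /andP[-> _] /and3P[-> -> _].
  by move: A1 B1; rewrite !mem_rcons !inE !negb_or => /andP[-> _] /andP[-> _].
(* If the cycle uses b, then [ha] must equal [lc], and [hb] differs from [la], [lb] and [ha], so no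
   value is left for it. If it uses c, the same holds with b and c exchanged. *)
case/orP: E => /far [n1 n2 n3 n4 n5].
  move: Ea; rewrite !inE (negPf n1) (negPf n3) /= => /eqP E.
  by move: Eb; rewrite !inE -E eq_sym (negPf n4) (negPf n5) eq_sym (negPf n2).
move: Ea; rewrite !inE (negPf n1) (negPf n3) /= orbF => /eqP E.
by move: Ec; rewrite !inE -E eq_sym (negPf n4) eq_sym (negPf n2) (negPf n5).
Qed.

(** The third thread is a single edge of colour h. The first colours of b and c turn out to be the
    last colours crosswise; then each cycle closed by a first edge must use the single edge, so h
    differs from all colours away from x, although these exhaust t. *)
Lemma colours_chord h hb hc lb lc g mb mc t :
  let b := hb :: g :: rcons mb lb in
  let c := hc :: rcons mc lc in
  uniq (behead b ++ behead c) -> uniq ((hb :: g :: mb) ++ hc :: mc) ->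
  uniq (hb :: rcons mb lb ++ c) || uniq (hb :: rcons mb lb ++ [:: h]) ->
  uniq (behead b ++ c) || uniq (behead b ++ [:: h]) ->
  uniq (behead c ++ b) || uniq (behead c ++ [:: h]) ->
  {subset h :: b ++ c <= t} -> size t + 3 <= size (h :: b ++ c) -> False.
Proof.
move=> b c U V E1 E2 E3 S sz.
have M : {subset t <= behead b ++ behead c}.
  apply: uniq_cover => //.
    move=> z zi; apply: S; move: zi; rewrite in_cons !mem_cat.
    by case/orP=> /mem_behead->; rewrite ?orbT.
  by move: sz; rewrite /= !size_cat /=; lia.
have ends k : k \in h :: b ++ c -> k \notin g :: mb -> k \notin mc ->
    k \in [:: lb; lc].
  move=> /S/M; rewrite !mem_cat -[behead b]/(rcons (g :: mb) lb) !mem_rcons !in_cons.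
  by move=> H /norP[/negPf n1 /negPf n2] /negPf n3; move: H; rewrite n1 n2 n3 !orbF.
have dis s s' z : uniq (s ++ s') -> z \in s -> z \notin s'.
  by rewrite cat_uniq => /and3P[_ /hasPn H _] zs; apply/negP=> /H; rewrite /= zs.
have Eb : hb \in [:: lb; lc].
  apply: ends; first by rewrite in_cons mem_cat mem_head orbT.
  - by case: (uniq_cons_cat V).
  - by have := dis _ _ hb V (mem_head _ _); rewrite inE negb_or => /andP[].
have Vc := V; rewrite uniq_catC in Vc.
have Ec : hc \in [:: lb; lc].
  apply: ends; first by rewrite in_cons !mem_cat mem_head !orbT.
  - by have := dis _ _ hc Vc (mem_head _ _); rewrite inE negb_or => /andP[].
  - by case: (uniq_cons_cat Vc).
have nbc : hb != hc.
  by have := dis _ _ hb V (mem_head _ _); rewrite inE negb_or => /andP[].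
have nb : hb != lb.
  by case/orP: E1; rewrite -cat_cons => /uniq_cons_cat[+ _];
    rewrite mem_rcons inE negb_or => /andP[].
move: Eb; rewrite !inE (negPf nb) /= => /eqP Eb.
move: Ec; rewrite !inE -Eb (eq_sym hc hb) (negPf nbc) orbF => /eqP Ec.
(* The alternative running through c is impossible, since [hc] equals [lb]. *)
have nhb : h \notin behead b.
  case/orP: E2 => W.
    have := dis _ _ hc W; rewrite mem_head Ec /= in_cons mem_rcons mem_head orbT.
    by move/(_ isT).
  by apply/negP=> /(dis _ _ h W); rewrite mem_head.
have nhc : h \notin behead c.
  case/orP: E3 => W.
    have := dis _ _ hb W; rewrite mem_head Eb /= mem_rcons mem_head.
    by move/(_ isT).
  by apply/negP=> /(dis _ _ h W); rewrite mem_head.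
have /S/M : h \in h :: b ++ c by rewrite mem_head.
by rewrite mem_cat (negPf nhb) (negPf nhc).
Qed.
End ColourLists.

(** * The lower bounds on the number of edges *)

Section Final.
Variables (T : finType) (G : sgraph T) (c : {set T} -> nat).
Hypothesis rc : rainbow_2connected G c.

(** Two disjoint paths from x to y are two threads. The third starts with the remaining neighbour w
    of x and follows a path to y avoiding x. *)
Lemma theta_exists x y : x != y -> #|nbrs G x| = 3 ->
  (forall v, v != x -> v != y -> #|nbrs G v| = 2) ->
  exists A B C, theta G x y A B C.
Proof.
move=> xy d3 d2; have [p [q [D _ _]]] := rainbow_paths rc xy.
have [a [p' [b [q' [Ep Eq ab ga gb]]]]] := disjoint_paths_head xy D.
have [w] : exists w, w \in nbrs G x :\: [set a; b].
  apply/set0Pn; rewrite -card_gt0 cardsD d3.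
  by have := subset_leq_card (subsetIr (nbrs G x) [set a; b]); rewrite cards2 ab; lia.
rewrite !inE negb_or -andbA => /and3P[wa wb gw].
have xw : x != w by apply: contraTneq gw => <-; rewrite adj_irr.
have [P Q n Dis] := D.
(* A path from w cannot step onto r before y: the inner vertices of r have degree 2 and both their
   edges lie on r. *)
have outside r s : is_path G x y r -> w != head x r -> w != y ->
    is_path G w y s -> x \notin s ->
    forall z, z \in w :: s -> z != y -> z \notin x :: r.
  move=> R wr wy /and3P[ps /eqP ls Us] xs z zs zy.
  have xr : x \notin r by case/and3P: R => _ _ /andP[].
  have wout : w \notin x :: r.
    rewrite inE negb_or eq_sym xw; apply: contra wr => wr; apply/eqP.
    apply: (edge_at_head xr); rewrite setUC.
    by apply: inner_saturated R wr wy (d2 _ _ wy) _; rewrite 1?eq_sym // adj_sym.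
  case: (eqVneq z w) => [-> //|zw]; rewrite inE (negPf zw) /= in zs.
  case/splitPr: zs ps ls Us xs => s1 s2 ps ls Us xs.
  have ys1 : y \notin rcons s1 z.
    rewrite mem_rcons inE negb_or eq_sym zy /=.
    move: Us; rewrite -cat_cons cat_uniq => /and3P[_ /hasPn H _].
    have : y \in z :: s2 by rewrite -ls last_cat /= mem_last.
    by move/H; rewrite /= inE negb_or => /andP[].
  have : [pred t | t \notin x :: r] (last w (rcons s1 z)).
    apply: (@path_closed _ G) => //; last first.
      by move: ps; rewrite -cat_rcons cat_path => /andP[].
    move=> d e /= dn es g; rewrite inE negb_or.
    have ex : e != x.
      apply: contraNneq xs => <-; rewrite -cat_rcons mem_cat es //.
    rewrite ex /=; apply: contra dn => er.
    have ey : e != y by apply: contraNneq ys1 => <-.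
    rewrite adj_sym in g.
    have := inner_saturated R er ey (d2 _ ex ey) g.
    by move/mem_path_edges/(_ (set22 _ _)).
  by rewrite last_rcons.
have [s [Sp Sout]] : exists s, is_path G x y (w :: s) /\
   forall z, z \in w :: s -> z != y -> (z \notin p) && (z \notin q).
  (* If w is y, the third thread is the edge from x to y. *)
  case: (eqVneq w y) => [wy|wy].
    exists [::]; split; last by move=> z; rewrite inE wy => /eqP->; rewrite eqxx.
    by rewrite /is_path /= gw wy eqxx inE xy.
  have [s [Sp _ xs]] := rainbow_path_avoid rc wy xy.
  exists s; split.
    case/and3P: Sp => p1 p2 p3; apply/and3P; split=> //; first by rewrite /= gw.
    by rewrite cons_uniq inE negb_or xw xs.
  move=> z zs zy.
  have := outside p s P _ wy Sp xs z zs zy; rewrite Ep /= => /(_ wa).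
  have := outside q s Q _ wy Sp xs z zs zy; rewrite Eq /= => /(_ wb).
  by rewrite !(inE, negb_or) => /andP[_ ->] /andP[_ ->].
have EE : forall d e, G d e -> [set d; e] \in path_edges x p ++ path_edges x q ++ path_edges x (w :: s).
  apply: (@all_edges _ _ _ rc [pred z | [|| z \in x :: p, z \in x :: q | z \in x :: w :: s]] _ x y xy).
    by rewrite /= mem_head.
  move=> d e Sd dy g.
  have H : [set d; e] \in path_edges x p ++ path_edges x q ++ path_edges x (w :: s).
    case: (eqVneq d x) => [dx|dx].
      subst d; have : e \in [:: a; b; w].
        by apply: nbrs3 d3 _ ga gb gw g; rewrite /= !inE negb_or ab !(eq_sym _ w) wa wb.
      by rewrite Ep Eq !mem_cat !inE => /or3P[]/eqP->; rewrite eqxx ?orbT.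
    move: Sd; rewrite [X in X -> _]/= ![_ \in x :: _]inE (negPf dx) /= !mem_cat.
    by case/or3P=> di; rewrite (inner_saturated _ di dy (d2 _ dx dy) g) ?orbT.
  split=> //; move: H; rewrite !mem_cat.
  by case/or3P=> /mem_path_edges/(_ (set22 _ _)) H; rewrite /= H ?orbT.
have [A EA] := is_path_rcons xy P; have [B EB] := is_path_rcons xy Q.
have [C EC] := is_path_rcons xy Sp.
have inP E r : is_path G x y r -> r = rcons E y ->
    uniq E /\ forall z, z \in E -> [/\ z \in r, z != x & z != y].
  move=> + Er; rewrite Er => /and3P[_ _].
  rewrite cons_uniq mem_rcons inE negb_or rcons_uniq => /and3P[/andP[_ xE] yE UE].
  split=> // z zE; rewrite mem_rcons inE zE orbT; split=> //.
    by apply: contraNneq xE => <-.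
  by apply: contraNneq yE => <-.
have [UA iA] := inP _ _ P EA; have [UB iB] := inP _ _ Q EB.
have [UC iC] := inP _ _ Sp EC.
have nilP E h r : h :: r = rcons E y -> (h != y) <= (E != [::]).
  by case: E => [[->]|e E _]; rewrite ?eqxx // leq_b1.
exists A, B, C; split.
- by rewrite -EA.
- by rewrite -EB.
- by rewrite -EC.
- apply: uniq_cat3; rewrite cat_uniq ?UA ?UB ?UC /= ?andbT.
  + by move: Dis; rewrite EA EB /inner !belast_rcons.
  + by apply/hasPn=> z zC; have [z1 _ z2] := iC _ zC; have := Sout z z1 z2;
      apply: contraL => /= zB; have [-> _ _] := iB _ zB; rewrite andbF.
  + by apply/hasPn=> z zC; have [z1 _ z2] := iC _ zC; have := Sout z z1 z2;
      apply: contraL => /= zA; have [-> _ _] := iA _ zA.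
- by move=> z; rewrite !mem_cat => /or3P[/iA|/iB|/iC][_ zx zy]; apply: d2.
- by move=> d e /EE; rewrite /thread -EA -EB -EC.
(* The first vertices a, b, w are distinct, so at most one of them is y; the other threads have an
   inner vertex. *)
have h1 : (a != y) <= (A != [::]) by apply: (nilP _ _ p'); rewrite -EA.
have h2 : (b != y) <= (B != [::]) by apply: (nilP _ _ q'); rewrite -EB.
have h3 := nilP _ _ _ EC.
apply: leq_trans (leq_add (leq_add h1 h2) h3).
by move/eqP: ab; move/eqP: wa; move/eqP: wb; case: eqP; case: eqP; case: eqP => //= *; congruence.
Qed.

Lemma theta_behead_belast x y A B C : theta G x y A B C -> A != [::] -> B != [::] ->
  let a := map c (thread x y A) in let b := map c (thread x y B) in
  uniq (behead a ++ behead b) /\ uniq (behead (rev a) ++ behead (rev b)).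
Proof.
move=> th A0 B0; split.
  by case: A B th A0 B0 => // u A [] // v B th _ _; apply: theta_behead th.
rewrite -!map_rev -!thread_rev; have := theta_rev th.
have nil0 D : D != [::] -> rev D != [::] :> seq T by rewrite -!size_eq0 size_rev.
move: (nil0 _ A0) (nil0 _ B0).
case: (rev A) => // u A'; case: (rev B) => // v B' _ _ th'.
exact: theta_behead th'.
Qed.

(** Translates the closing of a cycle into colours: the position of k in the colour sequence
    determines which edge is left out. *)
Lemma theta_edge_colours x y A B C s1 k s2 : theta G x y A B C -> A != [::] ->
  map c (thread x y A) = s1 ++ k :: s2 ->
  uniq (s1 ++ s2 ++ map c (thread x y B)) ||
  uniq (s1 ++ s2 ++ map c (thread x y C)).
Proof.
move=> th A0 E.
have sz := congr1 size E.
rewrite size_map /thread size_pairmap size_cat /= in sz.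
have lt1 : size s1 < size (rcons A y) by rewrite sz addnS ltnS leq_addr.
have [p1 [b [p2 [ER sz1]]]] : exists p1 b p2,
    rcons A y = p1 ++ b :: p2 /\ size p1 = size s1.
  exists (take (size s1) (rcons A y)), (nth y (rcons A y) (size s1)),
    (drop (size s1).+1 (rcons A y)).
  by rewrite -drop_nth // cat_take_drop size_take lt1.
have := theta_edge rc th A0 ER; rewrite !map_cat -!catA.
move/eqP: E; rewrite /thread ER path_edges_cat map_cat eqseq_cat; last first.
  by rewrite size_map size_pairmap.
by case/andP=> /eqP -> /eqP[_ ->].
Qed.

(** Seven edges give at least four inner vertices, so some thread has two of them and thus a middle
    edge. The cases are whether or not a thread is a single edge. *)
Lemma theta_colours x y A B C t : theta G x y A B C -> 7 <= #|edges G| ->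
  size t + 3 <= #|edges G| -> (forall e, e \in edges G -> c e \in t) -> False.
Proof.
move=> th0 le7 let_ ct.
have ctD D : is_path G x y (rcons D y) -> {subset map c (thread x y D) <= t}.
  move=> /and3P[pD _ _] k /mapP[e eD ->]; apply/ct/edgesP.
  have [p1 [z [p2 [Ep Ee]]]] := path_edges_split eD.
  exists (last x p1), z; split=> //.
  by apply: path_edges_adj pD _; rewrite -Ee.
have sub A1 B1 C1 : theta G x y A1 B1 C1 ->
    {subset map c (thread x y A1) ++ map c (thread x y B1) ++ map c (thread x y C1) <= t}.
  case=> p1 p2 p3 _ _ _ _ k; rewrite !mem_cat.
  by case/or3P; apply: ctD.
have sz A1 B1 C1 : theta G x y A1 B1 C1 -> size t + 3 <=
    size (map c (thread x y A1) ++ map c (thread x y B1) ++ map c (thread x y C1)).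
  by move=> th; rewrite -!map_cat size_map (leq_trans let_ (theta_card th)).
have szD D : size (map c (thread x y D)) = (size D).+1.
  by rewrite size_map size_pairmap size_rcons.
have shape2 (s : seq nat) : 1 < size s -> exists h m l, s = h :: rcons m l.
  case: s => [|h s] //; case/lastP: s => // m l _; by exists h, m, l.
have shape3 (s : seq nat) : 2 < size s -> exists h g m l, s = h :: g :: rcons m l.
  case: s => [|h [|g s]] //; case/lastP: s => // m l _; by exists h, g, m, l.
have big A1 B1 C1 : theta G x y A1 B1 C1 -> 3 < size A1 + size B1 + size C1.
  move=> th; have := theta_card th.
  by rewrite !size_cat /thread !size_pairmap !size_rcons; lia.
have nilE (D : seq T) : (D != [::]) = (0 < size D) by case: D.
have long A1 B1 C1 : theta G x y A1 B1 C1 -> 1 < size A1 -> 0 < size B1 ->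
    0 < size C1 -> False.
  move=> th a2 b1 c1; have thAC := theta_rot (theta_swap th).
  have [A0 B0 C0] : [/\ A1 != [::], B1 != [::] & C1 != [::]].
    by rewrite !nilE b1 c1; split=> //; apply: ltnW.
  have [U1 V1] := theta_behead_belast th A0 B0.
  have [U2 V2] := theta_behead_belast (theta_rot th) B0 C0.
  have [U3 V3] := theta_behead_belast thAC A0 C0.
  move: (sub _ _ _ th) (sz _ _ _ th) => S Z.
  have [|ha [g [ma [la Ea]]]] := shape3 (map c (thread x y A1)); first by rewrite szD.
  have [|hb [mb [lb Eb]]] := shape2 (map c (thread x y B1)); first by rewrite szD.
  have [|hc [mc [lc Ec]]] := shape2 (map c (thread x y C1)); first by rewrite szD.
  (* Leaving out the second edge, which is a middle edge of a thread with at least three edges. *)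
  have E := theta_edge_colours (s1 := [:: ha]) th A0 Ea.
  rewrite {}Ea {}Eb {}Ec in U1 U2 U3 V1 V2 V3 S Z E.
  rewrite -!rcons_cons !uniq_behead_rev in V1 V2 V3.
  exact: colours_long U1 U2 U3 V1 V2 V3 E S Z.
have chord B1 C1 : theta G x y [::] B1 C1 -> 1 < size B1 -> 0 < size C1 -> False.
  move=> th b2 c1.
  have [B0 C0] : B1 != [::] /\ C1 != [::] by rewrite !nilE c1; split=> //; apply: ltnW.
  have [U V] := theta_behead_belast (theta_rot th) B0 C0.
  move: (sub _ _ _ th) (sz _ _ _ th) => S Z.
  have [|hb [g [mb [lb Eb]]]] := shape3 (map c (thread x y B1)); first by rewrite szD.
  have [|hc [mc [lc Ec]]] := shape2 (map c (thread x y C1)); first by rewrite szD.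
  (* The edges left out are a middle edge of the longer thread, its first edge, and the first edge
     of the other thread. *)
  have E1 := theta_edge_colours (s1 := [:: hb]) (theta_rot th) B0 Eb.
  have E2 := theta_edge_colours (s1 := [::]) (theta_rot th) B0 Eb.
  have E3 := theta_edge_colours (s1 := [::]) (theta_swap (theta_rot th)) C0 Ec.
  rewrite {}Eb {}Ec in U V E1 E2 E3 S Z.
  rewrite -!rcons_cons uniq_behead_rev in V.
  exact: colours_chord U V E1 E2 E3 S Z.
have chord2 B1 C1 : theta G x y [::] B1 C1 -> False.
  move=> th; have := big _ _ _ th; have := theta_nil th; rewrite !nilE /= => n s.
  case: (ltnP 1 (size B1)) => b2; first by apply: (chord _ _ th) => //; lia.
  by apply: (chord _ _ (theta_rot (theta_swap th))); lia.
have th1 := theta_rot th0; have th2 := theta_rot th1.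
case: (posnP (size A)) => [/size0nil A0|A0]; first by rewrite A0 in th0; apply: chord2 th0.
case: (posnP (size B)) => [/size0nil B0|B0]; first by rewrite B0 in th1; apply: chord2 th1.
case: (posnP (size C)) => [/size0nil C0|C0]; first by rewrite C0 in th2; apply: chord2 th2.
have b := big _ _ _ th0.
case: (ltnP 1 (size A)) => a2; first exact: long th0 _ _ _.
case: (ltnP 1 (size B)) => b2; first exact: long th1 _ _ _.
by apply: (long _ _ _ th2); lia.
Qed.

Lemma rainbow_edges_lower r : colouring G r c -> 2 < #|T| -> #|T| = r.+1 ->
  #|T| < #|edges G|.
Proof.
move=> col gt2 Er.
have d2 v : 2 <= #|nbrs G v| by apply: (rainbow_deg_ge2 rc); lia.
rewrite ltnNge; apply/negP=> le.
have ge := card_edges_ge d2.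
have inj := rainbow_cycle rc (deg_cycle d2 le) (leq_trans gt2 ge).
have : size (map c (enum (edges G))) <= size (iota 1 r).
  apply: uniq_leq_size.
    rewrite map_inj_in_uniq ?enum_uniq // => e f; rewrite !mem_enum; exact: inj.
  move=> k /mapP[e]; rewrite mem_enum => /col H ->; rewrite mem_iota; lia.
by rewrite size_map size_iota -cardE => /(leq_trans ge); rewrite Er ltnn.
Qed.

(** The previous bound, with one more colour allowed, excludes up to n edges. For n + 1 edges the
    total excess 2 gives one vertex of degree 4 or a theta graph, where r + 3 equals the number of
    edges. *)
Lemma rainbow_edges_lower2 r : colouring G r c -> 5 < #|T| -> #|T| = r.+2 ->
  #|T|.+1 < #|edges G|.
Proof.
move=> col gt5 Er.
have d2 v : 2 <= #|nbrs G v| by apply: (rainbow_deg_ge2 rc); lia.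
have gtT : #|T| < #|edges G|.
  apply: (@rainbow_edges_lower r.+1); rewrite -?Er //; last lia.
  by move=> e /col; lia.
rewrite ltn_neqAle gtT andbT; apply/eqP => /esym eE.
have [x [[x4 H]|[y [xy dx _ H]]]] := deg_theta d2 eE.
  by apply: (no_deg4 rc) x4 H; lia.
have [A [B [C th]]] := theta_exists xy dx H.
apply: (theta_colours (t := iota 1 r) th); rewrite ?size_iota; try lia.
by move=> e /col H1; rewrite mem_iota; lia.
Qed.

End Final.

(** * Extremal graphs *)

Section Cycles.
Variables (T : finType) (G : sgraph T) (c : {set T} -> nat).
Implicit Types (u v : T) (p q : seq T).

(** The cycle is stored as an arc from u to v and one back; each list omits its start, so [p ++ q]
    has every vertex once. Only the arcs must be rainbow, and the size bound excludes going back
    along the same edge. *)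
Definition rainbow_cycle_through u v p q :=
  [/\ path G u p && path G v q, last u p = v, last v q = u,
      uniq (p ++ q) && (2 < size (p ++ q)) & rainbow c u p && rainbow c v q].

Lemma rainbow_cycle_throughC u v p q :
  rainbow_cycle_through u v p q -> rainbow_cycle_through v u q p.
Proof.
case=> /andP[p1 q1] l1 l2 /andP[U s] /andP[r1 r2]; split=> //; first exact/andP.
  by rewrite uniq_catC U size_cat addnC -size_cat.
exact/andP.
Qed.

Lemma rainbow_cycle_disjoint_paths u v p q : u != v ->
  rainbow_cycle_through u v p q -> exists p' q',
    [/\ is_path G u v p' && rainbow c u p', is_path G u v q' && rainbow c u q',
        p' != q' & ~~ has (mem (inner u p')) (inner u q')].
Proof.
move=> uv [/andP[pp pq] lp lq /andP[U s] /andP[rp rq]].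
have disj z : z \in p -> z \notin q.
  move=> zp; move: U; rewrite cat_uniq => /and3P[_ /hasPn H _].
  by apply/negP=> /H; rewrite /= zp.
have uq : u \in q.
  by rewrite -lq; case: (q) lq => [vu|a q' _] /=; [rewrite -vu eqxx in uv|rewrite mem_last].
have vp : v \in p.
  by rewrite -lp; case: (p) lp => [vu|a q' _] /=; [rewrite -vu eqxx in uv|rewrite mem_last].
have /and3P[Up _ Uq] : [&& uniq p, ~~ has (mem p) q & uniq q] by rewrite -cat_uniq.
have P : is_path G u v p.
  by rewrite /is_path pp lp eqxx /= Up andbT; apply: contraL uq => /disj.
have Q : is_path G v u q by rewrite /is_path pq lq eqxx /= Uq andbT disj.
have Q' := is_path_rev Q.
have inQ z : z \in rev (belast v q) -> z != v -> z \in q.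
  rewrite mem_rev => /mem_belast; rewrite inE => /orP[/eqP->|//].
  by rewrite eqxx.
exists p, (rev (belast v q)); split.
- by rewrite P.
- by rewrite Q' /= -{1}lq /rainbow path_edges_rev map_rev rev_uniq.
(* Equal paths would share their first vertex, which must then be v; both arcs would be single edges
   and the cycle too short. *)
- apply/eqP=> E; have sE : size p = size q by rewrite {1}E size_rev size_belast.
  case: p {pp rp} s disj sE E lp vp Up {U P} => [|a p] s disj sE E lp vp Up.
    by rewrite size_cat -sE in s.
  have := disj a (mem_head _ _); rewrite inQ ?E ?mem_head // -?E ?mem_head //.
  apply: contraTneq s => av; case: p {disj E} lp Up vp sE => [|b p] /= lp Up _ sE.
    by rewrite -sE.
  by case/andP: Up; rewrite av -{1}lp mem_last.
apply/hasPn=> z; rewrite /= (mem_inner _ Q') (mem_inner _ P) => /andP[zq zv].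
by rewrite negb_and (contraL (@disj z)) // inQ.
Qed.

(** At most one vertex is deleted, and one of two disjoint paths avoids it. *)
Lemma rainbow_2connected_k_connected : rainbow_2connected G c -> 2 < #|T| ->
  k_connected 2 G.
Proof.
move=> rc T2; split=> // X X1 u v; rewrite !inE => uX vX.
case: (eqVneq u v) => [->|uv]; first exact: connect0.
have [p [/and3P[pp /eqP lp _] _ pX]] : exists p,
    [/\ is_path G u v p, rainbow c u p & forall z, z \in X -> z \notin p].
  case: (set_0Vmem X) => [X0|[z zX]].
    have [p [q [[P _ _ _] rp _]]] := rainbow_paths rc uv.
    by exists p; split=> // z; rewrite X0 inE.
  have zv : z != v by apply: contraNneq vX => <-.
  have [p [P rp zp]] := rainbow_path_avoid rc uv zv.
  exists p; split=> // t tX; suff -> : t = z by [].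
  by apply: (card_le1_eqP (A := mem X)) => //; rewrite -ltnS.
apply/connectP; exists p => //; elim: p u uX pp pX {lp uv} => [|a p IH] u //= uX /andP[ua pp] pX.
have aX : a \notin X by apply/negP=> /pX; rewrite mem_head.
rewrite !inE uX aX ua /=; apply: IH => // z /pX.
by rewrite inE negb_or => /andP[].
Qed.

End Cycles.

(** Strong induction; excluded middle decides whether a smaller value exists, as P is arbitrary. *)
Lemma minimum_exists (P : nat -> Prop) m : P m -> exists2 k, is_minimum P k & k <= m.
Proof.
elim/ltn_ind: m => m IH Pm.
case: (classic (exists2 k, k < m & P k)) => [[k km Pk]|H].
  by have [j Mj jk] := IH k km Pk; exists j => //; lia.
exists m => //; split=> // k Pk; rewrite leqNgt; apply/negP => km.
by apply: H; exists k.
Qed.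

(** * Graphs on ordinals given by relations on the natural numbers *)

Section NatGraph.
Variables (n : nat) (n_gt0 : 0 < n) (E : rel nat) (col : nat -> nat -> nat).
Hypotheses (E_sym : symmetric E) (E_irr : irreflexive E).
Hypothesis col_sym : forall i j, col i j = col j i.

Definition nat_rel : rel 'I_n := fun i j => E i j.

Lemma nat_rel_sym : symmetric nat_rel.
Proof. by move=> i j; apply: E_sym. Qed.

Lemma nat_rel_irr : irreflexive nat_rel.
Proof. by move=> i; apply: E_irr. Qed.

Definition nat_graph := SGraph nat_rel_sym nat_rel_irr.

(** By symmetry of [col] the choice of the ordered pair is immaterial; the default 0 is never
    reached on an edge. *)
Definition nat_colour (e : {set 'I_n}) : nat :=
  if [pick p : 'I_n * 'I_n | e == [set p.1; p.2]] is Some p then col p.1 p.2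
  else 0.

Lemma nat_colourE (i j : 'I_n) : nat_colour [set i; j] = col i j.
Proof.
rewrite /nat_colour; case: pickP => [[k l] /= /eqP /set2_eq[] [-> ->]//|].
by move/(_ (i, j)); rewrite eqxx.
Qed.

Definition nat_ord : nat -> 'I_n := insubd (Ordinal n_gt0).

Lemma nat_ordK i : i < n -> nat_ord i = i :> nat.
Proof. by move=> lt_in; rewrite /nat_ord val_insubd lt_in. Qed.

Lemma nat_seqE p : all (fun i => i < n) p -> p = map (@nat_of_ord n) (map nat_ord p).
Proof.
move=> /allP H; rewrite -map_comp -[LHS]map_id; apply/eq_in_map => i /H.
by move/nat_ordK.
Qed.

Lemma nat_rainbow (u : 'I_n) (p : seq 'I_n) :
  rainbow nat_colour u p = uniq (pairmap col u (map (@nat_of_ord n) p)).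
Proof.
congr (uniq _); elim: p u => [|a p IH] u //=; rewrite nat_colourE.
by congr cons; apply: IH.
Qed.

Definition nat_cycle u v p q :=
  [/\ path E u p && path E v q, last u p = v, last v q = u,
      uniq (p ++ q) && (2 < size (p ++ q))
    & uniq (pairmap col u p) && uniq (pairmap col v q)].

Lemma nat_rainbow_2connected :
  (forall u v, u < v -> v < n -> exists p q, nat_cycle u v p q /\
     all (fun i => i < n) (p ++ q)) ->
  rainbow_2connected nat_graph nat_colour.
Proof.
move=> H.
have main (u v : 'I_n) : u < v -> exists p q,
    rainbow_cycle_through nat_graph nat_colour u v p q.
  move=> uv; have [p [q [[P l1 l2 U r]]]] := H u v uv (ltn_ord v).
  rewrite all_cat => /andP[/nat_seqE Ep /nat_seqE Eq].
  exists (map nat_ord p), (map nat_ord q).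
  split; last by rewrite !nat_rainbow -Ep -Eq.
  - have pE (w : 'I_n) s : path nat_rel w s = path E w (map (@nat_of_ord n) s).
      by rewrite path_map.
    by rewrite /= !pE -Ep -Eq.
  - by apply: ord_inj; rewrite -last_map -Ep.
  - by apply: ord_inj; rewrite -last_map -Eq.
  rewrite -map_cat size_map; case/andP: U => U ->; rewrite andbT.
  by rewrite -(map_inj_uniq (@ord_inj n)) !map_cat -Ep -Eq.
move=> u v uv; case: (ltngtP u v) => [lt|lt|/val_inj E1].
- by have [p [q]] := main _ _ lt; apply: rainbow_cycle_disjoint_paths.
- have [p [q /rainbow_cycle_throughC]] := main _ _ lt.
  exact: rainbow_cycle_disjoint_paths.
by rewrite E1 eqxx in uv.
Qed.

Lemma nat_card_edges (L : seq (nat * nat)) :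
  (forall i j, j < n -> E i j -> i < j -> (i, j) \in L) -> #|edges nat_graph| <= size L.
Proof.
move=> H; rewrite -(size_map (fun p => [set nat_ord p.1; nat_ord p.2])).
apply: leq_trans (card_size _); apply/subset_leq_card/subsetP => e.
have ordK (k : 'I_n) : nat_ord k = k by apply: val_inj; rewrite /= nat_ordK.
case/edgesP=> a [b [g ->]]; apply/mapP.
case: (ltngtP a b) => [lt|lt|/val_inj ab].
- by exists (val a, val b); rewrite /= ?ordK //; apply: H.
- exists (val b, val a); rewrite /= ?ordK; last by rewrite setUC.
  by apply: H => //; rewrite E_sym.
by move: g; rewrite ab adj_irr.
Qed.

End NatGraph.

(* A cycle 0, ..., m-1 with pairwise different colours, together with vertices
   m and m+1 that are both adjacent to the two vertices 0 and m-1. The edges at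
   m repeat the colours of the cycle edges next to {0, m-1}, crosswise; both
   edges at m+1 repeat the colour of {0, m-1}. *)
Section TwinGraph.
Variable m : nat.
Hypothesis m_ge3 : 3 <= m.

Definition twin_rel : rel nat := fun i j =>
  let a := minn i j in let b := maxn i j in
  (a < b) && (if b < m then (b == a.+1) || (a == 0) && (b == m.-1)
              else (a == 0) || (a == m.-1)).

(** The cycle edge between i and i + 1 has colour i + 1 and the closing edge has colour m, so its
    neighbours on the cycle have colours 1 and m - 1. *)
Definition twin_col i j :=
  let a := minn i j in let b := maxn i j in
  if b < m then (if b == a.+1 then b else m)
  else if b == m then (if a == 0 then m.-1 else 1) else m.

Lemma twin_rel_sym : symmetric twin_rel.
Proof. by move=> i j; rewrite /twin_rel minnC maxnC. Qed.

Lemma twin_rel_irr : irreflexive twin_rel.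
Proof. by move=> i; rewrite /twin_rel minnn maxnn ltnn. Qed.

Lemma twin_col_sym i j : twin_col i j = twin_col j i.
Proof. by rewrite /twin_col minnC maxnC. Qed.

Lemma twin_relE i j : i < j -> twin_rel i j =
  if j < m then (j == i.+1) || (i == 0) && (j == m.-1)
  else (i == 0) || (i == m.-1).
Proof.
by move=> ij; rewrite /twin_rel (minn_idPl (ltnW ij)) (maxn_idPr (ltnW ij)) ij.
Qed.

Lemma twin_colE i j : i < j -> twin_col i j =
  if j < m then (if j == i.+1 then j else m)
  else if j == m then (if i == 0 then m.-1 else 1) else m.
Proof.
by move=> ij; rewrite /twin_col (minn_idPl (ltnW ij)) (maxn_idPr (ltnW ij)).
Qed.

Lemma last_iota u k : last u (iota u.+1 k) = u + k.
Proof. by elim: k u => [|k IH] u /=; rewrite ?addn0 // IH addSnnS. Qed.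

Lemma twin_path_iota u k : u + k < m -> path twin_rel u (iota u.+1 k).
Proof.
elim: k u => [|k IH] u //= ltm; rewrite twin_relE // eqxx /= IH; last lia.
by case: ifP => //; lia.
Qed.

Lemma twin_col_iota u k : u + k < m -> pairmap twin_col u (iota u.+1 k) = iota u.+1 k.
Proof.
elim: k u => [|k IH] u //= ltm; rewrite twin_colE // eqxx IH; last lia.
by case: ifP => //; lia.
Qed.

Lemma twin_rel_wrap : twin_rel m.-1 0.
Proof. by rewrite twin_rel_sym twin_relE ?eqxx ?orbT; [case: ifP => //; lia|lia]. Qed.

Lemma twin_rel0 w : m <= w -> twin_rel 0 w.
Proof. by move=> mw; rewrite twin_relE ?eqxx ?orbT; [case: ifP => //; lia|lia]. Qed.

Lemma twin_rel_last w : m <= w -> twin_rel m.-1 w.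
Proof. by move=> mw; rewrite twin_relE ?eqxx ?orbT; [case: ifP => //; lia|lia]. Qed.

Lemma twin_col_wrap : twin_col m.-1 0 = m.
Proof.
rewrite twin_col_sym twin_colE; last lia.
by case: ifP => [_|]; [case: ifP => //; lia|lia].
Qed.

Lemma twin_col_0m : twin_col 0 m = m.-1.
Proof. by rewrite twin_colE ?eqxx ?ltnn //; lia. Qed.

Lemma twin_col_last_m : twin_col m.-1 m = 1.
Proof. by rewrite twin_colE ?eqxx ?ltnn; [case: ifP => //; lia|lia]. Qed.

Lemma twin_col_Sm i : i < m.+1 -> twin_col i m.+1 = m.
Proof.
move=> im; rewrite twin_colE //; case: ifP; first lia.
by case: ifP => //; lia.
Qed.

Lemma twin_path_up u w : u < m -> twin_rel m.-1 w ->
  path twin_rel u (iota u.+1 (m.-1 - u) ++ [:: w]).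
Proof.
move=> um; rewrite cat_path twin_path_iota; last lia.
by rewrite last_iota subnKC /= ?andbT //; lia.
Qed.

Lemma twin_col_up u w : u < m ->
  pairmap twin_col u (iota u.+1 (m.-1 - u) ++ [:: w]) =
  iota u.+1 (m.-1 - u) ++ [:: twin_col m.-1 w].
Proof.
move=> um; rewrite pairmap_cat twin_col_iota; last lia.
by rewrite last_iota subnKC //; lia.
Qed.

Lemma twin_path_down w u : u < m -> twin_rel w 0 -> path twin_rel w (iota 0 u.+1).
Proof. by move=> um E; apply/andP; split=> //; apply: twin_path_iota. Qed.

Lemma twin_col_down w u : u < m ->
  pairmap twin_col w (iota 0 u.+1) = twin_col w 0 :: iota 1 u.
Proof. by move=> um; rewrite -(@twin_col_iota 0 u). Qed.

Lemma uniq_catI (s t : seq nat) : uniq s -> uniq t ->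
  (forall z, z \in s -> z \in t -> False) -> uniq (s ++ t).
Proof.
move=> Us Ut H; rewrite cat_uniq Us Ut andbT; apply/hasPn => z zt.
by apply/negP => zs; apply: H zs zt.
Qed.

Ltac uniq_iota :=
  repeat match goal with |- is_true (uniq (_ ++ _)) => apply: uniq_catI end;
  rewrite ?iota_uniq //; move=> z; rewrite ?(mem_cat, mem_iota, inE); lia.

(** Two vertices of the original cycle use that cycle. A new vertex v and a cycle vertex u use the
    cycle with its closing edge replaced by the detour through v. The bound on the vertices keeps
    the cycle available when only m is added. *)
Lemma twin_cycle u v : u < v -> v < m.+2 -> exists p q,
  nat_cycle twin_rel twin_col u v p q /\ all (fun i => i <= maxn m.-1 v) (p ++ q).
Proof.
move=> uv vm.
have [vm'|mv] := ltnP v m.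
  exists (iota u.+1 (v - u)), (iota v.+1 (m.-1 - v) ++ iota 0 u.+1).
  split; last first.
    by apply/allP=> z; rewrite !mem_cat !mem_iota; lia.
  split.
  - rewrite twin_path_iota; last lia.
    rewrite cat_path twin_path_iota; last lia.
    rewrite last_iota subnKC; last lia.
    by apply: twin_path_down twin_rel_wrap; lia.
  - by rewrite last_iota; lia.
  - by rewrite last_cat /= last_iota add0n.
  - by rewrite !size_cat !size_iota; apply/andP; split; [uniq_iota|lia].
  rewrite pairmap_cat !twin_col_iota; try lia.
  rewrite last_iota subnKC; last lia.
  rewrite twin_col_down ?twin_col_wrap; last lia.
  by rewrite iota_uniq -cat1s; apply/andP; split; [|uniq_iota].
have [um|mu] := ltnP u m; last first.
  have [-> ->] : u = m /\ v = m.+1 by lia.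
  (* The two new vertices lie on a 4-cycle with 0 and m - 1. *)
  exists [:: 0; m.+1], [:: m.-1; m]; split; last by rewrite /=; lia.
  split=> //=.
  - by rewrite (twin_rel_sym m) (twin_rel_sym m.+1) !twin_rel0 ?twin_rel_last.
  - by rewrite andbT !inE; lia.
  rewrite (twin_col_sym m) (twin_col_sym m.+1) !twin_col_Sm ?twin_col_0m ?twin_col_last_m; try lia.
  by rewrite !inE; lia.
have [->|vm'] : v = m.+1 \/ v = m by lia.
  exists (iota u.+1 (m.-1 - u) ++ [:: m.+1]), (iota 0 u.+1).
  split; last by apply/allP=> z; rewrite !mem_cat !mem_iota inE; lia.
  split.
  - rewrite twin_path_up ?twin_rel_last // twin_path_down // twin_rel_sym twin_rel0 //.
  - by rewrite last_cat.
  - by rewrite /= last_iota.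
  - by rewrite !size_cat !size_iota; apply/andP; split; [uniq_iota|rewrite /=; lia].
  rewrite twin_col_up // twin_col_down //.
  rewrite (twin_col_sym m.+1) !twin_col_Sm; try lia.
  by rewrite -[m :: iota 1 u]cat1s; apply/andP; split; uniq_iota.
subst v; have r0 := twin_rel0 (leqnn m); have rl := twin_rel_last (leqnn m).
have c0 : twin_col m 0 = m.-1 by rewrite twin_col_sym twin_col_0m.
(* The detour through m repeats the colours 1 and m - 1, which spoils an arc when u is 0 or m - 1.
   These cases use the triangle on 0, m - 1 and m. *)
have [u0|u0] := posnP u.
  exists [:: m], [:: m.-1; 0]; split; last by rewrite /=; lia.
  rewrite u0; split=> //=.
  - by rewrite r0 (twin_rel_sym m) rl twin_rel_wrap.
  - by rewrite !inE; lia.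
  by rewrite (twin_col_sym m) twin_col_last_m twin_col_wrap !inE; lia.
have [ul|ul] := eqVneq u m.-1.
  exists [:: m], [:: 0; m.-1]; split; last by rewrite /=; lia.
  rewrite ul; split=> //=.
  - by rewrite rl (twin_rel_sym m) r0 (twin_rel_sym 0) twin_rel_wrap.
  - by rewrite !inE; lia.
  by rewrite c0 (twin_col_sym 0) twin_col_wrap !inE; lia.
exists (iota u.+1 (m.-1 - u) ++ [:: m]), (iota 0 u.+1).
split; last by apply/allP=> z; rewrite !mem_cat !mem_iota inE; lia.
split.
- by rewrite twin_path_up // twin_path_down // twin_rel_sym.
- by rewrite last_cat.
- by rewrite /= last_iota.
- by rewrite !size_cat !size_iota; apply/andP; split; [uniq_iota|rewrite /=; lia].
rewrite twin_col_up // twin_col_down // c0 twin_col_last_m.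
by rewrite -[m.-1 :: iota 1 u]cat1s; apply/andP; split; uniq_iota.
Qed.

Lemma twin_col_range i j : i < j -> j < m.+2 -> twin_rel i j -> 1 <= twin_col i j <= m.
Proof.
by move=> ij jm; rewrite twin_relE // twin_colE //; repeat case: ifP => /=; lia.
Qed.

Lemma twin_rel_card k i j : j < m + k -> twin_rel i j -> i < j -> (i, j) \in
  (0, m.-1) :: [seq (i, i.+1) | i <- iota 0 m.-1] ++
  [seq (0, j) | j <- iota m k] ++ [seq (m.-1, j) | j <- iota m k].
Proof.
move=> jk + ij; rewrite twin_relE // inE !mem_cat xpair_eqE; case: ifP => jm.
  case/orP=> [/eqP->|->//]; apply/orP; right; apply/orP; left.
  by rewrite (map_f (fun i => (i, i.+1))) // mem_iota; lia.
move=> H; apply/orP; right; apply/orP; right; apply/orP.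
by case/orP: H => /eqP ->; [left|right]; rewrite (map_f (fun j => (_, j))) // mem_iota; lia.
Qed.

(** With n = m + k vertices there are n - k colours and at most n + k edges: k = 1 and k = 2 give
    the two claims. *)
Lemma twin_graph k : 1 <= k <= 2 -> exists (T : finType) (G : sgraph T) c,
  [/\ #|T| = m + k, #|edges G| <= m + 2 * k, colouring G m c &
      rainbow_2connected G c].
Proof.
move=> k12; have n0 : 0 < m + k by lia.
exists 'I_(m + k), (nat_graph (m + k) twin_rel_sym twin_rel_irr), (nat_colour (n := m + k) twin_col).
split; first by rewrite card_ord.
- apply: leq_trans (nat_card_edges n0 _ _ (twin_rel_card (k := k))) _.
  by rewrite /= !size_cat !size_map !size_iota; lia.
- move=> e /edgesP[a [b [g ->]]]; rewrite nat_colourE; last exact: twin_col_sym.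
  have := ltn_ord a; have := ltn_ord b.
  case: (ltngtP a b) => [lt|lt|/val_inj ab]; last by rewrite ab adj_irr in g.
    by move=> H1 H2; apply: twin_col_range lt _ g; lia.
  move=> H1 H2; rewrite twin_col_sym; apply: twin_col_range lt _ _; first lia.
  by rewrite twin_rel_sym.
apply: (nat_rainbow_2connected n0); first exact: twin_col_sym.
move=> u v uv vn; have [|p [q [C A]]] := @twin_cycle u v uv; first lia.
exists p, q; split=> //; apply: sub_all A => z; lia.
Qed.

End TwinGraph.

(** An upper bound on the edges of the example suffices, since the lower bound applies to it as
    well. A graph whose rainbow 2-connection number is below r is also coloured with at most r
    colours. *)
Lemma is_t2I n r m :
  (exists (T : finType) (G : sgraph T) c, [/\ #|T| = n, #|edges G| <= m,
     colouring G r c & rainbow_2connected G c]) ->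
  (forall (T : finType) (G : sgraph T) c, #|T| = n -> colouring G r c ->
     rainbow_2connected G c -> m <= #|edges G|) -> 2 < n -> is_t2 n r m.
Proof.
move=> [T [G [c [Tn Em col rc]]]] low n3; split.
  exists T, G; split=> //.
  - by apply: rainbow_2connected_k_connected rc _; rewrite Tn.
  - by apply: minimum_exists; exists c.
  by apply/eqP; rewrite eqn_leq Em (low _ _ _ Tn col rc).
move=> e [T' [G' [T'n _ [k [[c' [col' rc']] _] kr] <-]]].
apply: low T'n _ rc' => f /col' /andP[-> H] /=; exact: leq_trans kr.
Qed.

Theorem theorem3p1 :
  (forall n : nat, 6 <= n -> is_t2 n (n - 2) (n + 2)) /\
  (forall n : nat, 4 <= n -> is_t2 n (n - 1) (n + 1)).
Proof.
split=> n le_n; apply: is_t2I; try lia.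
- have [||T [G [c [E1 E2 E3 E4]]]] := @twin_graph (n - 2) _ 2; try lia.
  by exists T, G, c; split=> //; rewrite ?E1 //; lia.
- move=> T G c Tn col rc; have := rainbow_edges_lower2 rc col.
  by rewrite Tn; lia.
- have [||T [G [c [E1 E2 E3 E4]]]] := @twin_graph (n - 1) _ 1; try lia.
  by exists T, G, c; split=> //; rewrite ?E1 //; lia.
move=> T G c Tn col rc; have := rainbow_edges_lower rc col.
by rewrite Tn; lia.
Qed.
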